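(* Suppose that $\mathcal{X}_j$ is a locally compact Hausdorff space for each $j \in [d]$, and that every open set in $\mathcal{X} = \prod_{j=1}^d \mathcal{X}_j$ is $\sigma$-compact (a countable union of compact sets). Then for any $P_{\mathbb{S}} \in \mathcal{P}_{\mathbb{S}}$, \[ R(P_{\mathbb{S}}) = \inf \bigl\{ \epsilon \in [0,1] : P_{\mathbb{S}} \in (1-\epsilon) \mathcal{P}_{\mathbb{S}}^0 + \epsilon \mathcal{P}_{\mathbb{S}}\bigr\} = 1 - \sup \bigl\{ \epsilon \in [0,1] : P_{\mathbb{S}} \in \epsilon \mathcal{P}_{\mathbb{S}}^0 + (1-\epsilon) \mathcal{P}_{\mathbb{S}}\bigr\}. \]
   Context: Let $d \in \mathbb{N}$, $[d]:=\{1,\ldots,d\}$, let $\mathcal{X}_1,\ldots,\mathcal{X}_d$ be (non-empty) topological spaces with their Borel $\sigma$-algebras, and for $S \subseteq [d]$ let $\mathcal{X}_S := \prod_{j \in S} \mathcal{X}_j$ with the product topology; $\mathcal{X} := \mathcal{X}_{[d]}$ and $x_S := (x_j: j \in S)$ for $x \in \mathcal{X}$. Let $\mathbb{S}$ be a non-empty collection of subsets of $[d]$. $\mathcal{P}_{\mathbb{S}}$ is the set of all sequences $P_{\mathbb{S}} = (P_S : S \in \mathbb{S})$ with $P_S$ a (Borel) probability distribution on $\mathcal{X}_S$. $\mathcal{P}_{\mathbb{S}}^0 \subseteq \mathcal{P}_{\mathbb{S}}$ is the set of compatible sequences, i.e. those for which there is a probability distribution on $\mathcal{X}$ with marginal $P_S$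 on $\mathcal{X}_S$ for every $S \in \mathbb{S}$. Convex combinations of sequences are taken componentwise, and $(1-\epsilon)\mathcal{P}_{\mathbb{S}}^0 + \epsilon \mathcal{P}_{\mathbb{S}} := \{(1-\epsilon) Q_{\mathbb{S}} + \epsilon T_{\mathbb{S}} : Q_{\mathbb{S}} \in \mathcal{P}_{\mathbb{S}}^0, T_{\mathbb{S}} \in \mathcal{P}_{\mathbb{S}}\}$. Incompatibility index: let $\mathcal{G}_S$ be the set of bounded upper semi-continuous functions $\mathcal{X}_S \to [-1,\infty)$, and \[ \mathcal{G}_{\mathbb{S}}^+ := \Bigl\{ f_{\mathbb{S}} = (f_S : S \in \mathbb{S}) \in \prod_{S \in \mathbb{S}} \mathcal{G}_S : \inf_{x \in \mathcal{X}} \sum_{S \in \mathbb{S}} f_S(x_S) \geq 0 \Bigr\}. \] Then $R(P_{\mathbb{S}}) := \sup_{f_{\mathbb{S}} \in \mathcal{G}_{\mathbb{S}}^+} R(P_{\mathbb{S}}, f_{\mathbb{S}})$, where $R(P_{\mathbb{S}}, f_{\mathbb{S}}) := -\frac{1}{|\mathbb{S}|}\sum_{S \in \mathbb{S}} \int_{\mathcal{X}_S} f_S \, dP_S$. *)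

(* Defs.v *)
From HB Require Import structures.
From mathcomp Require Import all_boot all_order all_algebra.
From mathcomp Require Import all_classical all_reals all_analysis.

Set Implicit Arguments.
Unset Strict Implicit.
Unset Printing Implicit Defensive.

Import Order.TTheory GRing.Theory Num.Theory.
Import numFieldNormedType.Exports.

Local Open Scope classical_set_scope.
Local Open Scope ring_scope.

(* The library does not join the pointed and topological structures of
   dependent products. *)
HB.instance Definition _ (I : Type) (T : I -> ptopologicalType) :=
  Pointed.on (prod_topology T).

(* Measurable types are pointed in the library, hence the pointed topological
   spaces below; the choice of the point plays no role. *)
Definition borel (T : ptopologicalType) : measurableType (@open T).-sigma :=
  g_sigma_algebraType (@open T).

Definition sigma_compact (T : topologicalType) (A : set T) :=
  exists2 K : (set T)^nat, (forall n, compact (K n)) & A = \bigcup_n K n.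

Definition upper_semicontinuous (T : topologicalType) (R : realType)
    (f : T -> R) :=
  forall x a, f x < a -> \forall y \near x, f y < a.

Section incompatibility.
Variables (R : realType) (d : nat) (X : 'I_d -> ptopologicalType).

Definition full_space : ptopologicalType := prod_topology X.

Definition sub_space (S : {set 'I_d}) : ptopologicalType :=
  prod_topology (fun j : {j : 'I_d | j \in S} => X (val j)).

Definition restr (S : {set 'I_d}) (x : full_space) : sub_space S :=
  fun j => x (val j).

Variable SS : {set {set 'I_d}}.

Definition member := {S : {set 'I_d} | S \in SS}.

Definition distributions :=
  forall S : member, probability (borel (sub_space (val S))) R.

Definition compatible : set distributions :=
  [set P | exists mu : probability (borel full_space) R,
     forall (S : member) (A : set (borel (sub_space (val S)))), measurable A ->
       P S A = pushforward mu
         (@restr (val S) : borel full_space -> borel (sub_space (val S))) A].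

(* The set a * D1 + b * D2.  Measures are functions on all sets, only their
   values on measurable sets are meaningful. *)
Definition mixture (a : R) (D1 : set distributions)
    (b : R) (D2 : set distributions) : set distributions :=
  [set P | exists2 Q, D1 Q & exists2 T, D2 T &
     forall (S : member) (A : set (borel (sub_space (val S)))), measurable A ->
       P S A = (a%:E * Q S A + b%:E * T S A)%E].

Definition usc_class (S : {set 'I_d}) : set (sub_space S -> R) :=
  [set f | [/\ bounded_fun f, upper_semicontinuous f & forall x, -1 <= f x]].

(* The sums are bounded because each f S is, so the real inf is the infimum. *)
Definition usc_family : set (forall S : member, sub_space (val S) -> R) :=
  [set f | (forall S, usc_class (f S)) /\
     0 <= inf [set \sum_(S : member) f S (@restr (val S) x) | x in setT]].

Definition incompat_at (P : distributions)
    (f : forall S : member, sub_space (val S) -> R) : R :=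
  - (#|SS|%:R^-1 * \sum_(S : member) \int[P S]_x f S x).

(* The set contains 0 and is bounded above by 1, as -1 <= f S. *)
Definition incompat_index (P : distributions) : R :=
  sup [set incompat_at P f | f in usc_family].

End incompatibility.

(* Main.v *)
Require Import Defs.
From HB Require Import structures.
From mathcomp Require Import all_boot all_order all_algebra finmap.
From mathcomp Require Import all_classical all_reals all_analysis.
From mathcomp Require Import measurable_realfun lra.

Set Implicit Arguments.
Unset Strict Implicit.
Unset Printing Implicit Defensive.

Import Order.TTheory GRing.Theory Num.Theory.
Import numFieldNormedType.Exports.

Local Open Scope classical_set_scope.
Local Open Scope ring_scope.

(** Call a measure [nu] on the full space a subcoupling of [P] when each of its
    marginals is at most the corresponding [P S].  Scaling the compatible part
    of a mixture shows that [P] lies in the (1 - e, e) mixture exactly when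
    there is a subcoupling of total mass 1 - e: the remainder [P S - nu_S] has
    the same mass [e] for every [S] and can be normalized.  On the dual side,
    the substitution [g S = (1 + f S) / |SS|] turns the index into one minus
    the least cost [sum_S int (g S) d(P S)] of nonnegative upper semicontinuous
    prices [g] with [sum_S g S (x_S) >= 1] everywhere.  So the theorem says that
    the largest mass of a subcoupling is the least cost of such prices.

    One inequality is integration of [sum_S g S (x_S) >= 1] against a
    subcoupling ([weak_duality]).  For the other one, let [price phi] be the
    least cost of lower semicontinuous prices whose sum dominates [phi].  This
    functional is sublinear, so the Hahn-Banach theorem provides an additive
    functional [L <= price] with [L 1 = price 1], and [A |-> L 1_A] is a
    finitely additive charge on all subsets, of mass [price 1], that is at most
    [P S] on cylinders over open sets ([price_charge]).  Tightness of the [P S]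
    makes the charge tight.  The sets that it approximates by compact sets from
    inside and open sets from outside form an algebra, on which it is countably
    additive by compactness; Caratheodory's extension gives a measure
    ([charge_extension]).  The algebra contains the cylinders over Borel sets
    and the open boxes, and sigma-compactness writes every open set as a
    countable union of members of the algebra, so the measure lives on all
    Borel sets of the product and is a subcoupling of mass [price 1]
    ([coupling_extension]).

    The prices have to be lower semicontinuous in this argument: it is the
    bound on open sets that outer regularity propagates to all Borel sets.  To
    return to upper semicontinuous prices, a compact covering argument replaces
    lower semicontinuous prices by upper semicontinuous minorants that lose
    little on a compact set ([usc_minorant]); off that set one pays the
    indicator of a closed set of small measure, which exists by local
    compactness ([usc_prices_approx]).

    A coordinate that belongs to no member of [SS] is not controlled by [P] and
    could carry the charge away from all compact sets.  Such coordinates are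
    pinned at the base point: prices only have to dominate at [pinned] points,
    which changes nothing as prices do not see the pinned coordinates. *)

(** * Sublinear functionals and the Hahn-Banach theorem *)

(** Homogeneity is only asked for natural multiples, and as the inequality that
    subadditivity does not give, so that the notion makes sense on abelian
    groups. *)
Definition sublinear {R : realType} {V : zmodType} (q : V -> R) :=
  (forall u v, q (u + v) <= q u + q v) /\
  (forall v n, n%:R * q v <= q (v *+ n)).

Section hahn_banach.
Variables (R : realType) (V : zmodType).
Implicit Types (q : V -> R) (u v w : V).

Lemma sublinear0 q : sublinear q -> q 0 = 0.
Proof.
move=> [qD qM]; have := qD 0 0; have := qM 0 2%N.
by rewrite addr0 mul0rn; lra.
Qed.

Lemma sublinearMn q v n : sublinear q -> q (v *+ n) = n%:R * q v.
Proof.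
move=> sq; apply/eqP; rewrite eq_le sq.2 andbT.
elim: n => [|n IHn]; first by rewrite mulr0n mul0r sublinear0.
rewrite mulrSr (le_trans (sq.1 _ _))// -natr1 mulrDl mul1r lerD2r//.
Qed.

(** Adding [v] to [w] costs at most [q v] each time; [slope] is what remains
    after this maximal price has been deducted, hence it decreases with the
    number of copies.  Its limit [tilt q v] is the sublinear functional below
    [q] that is linear along [v]: it takes the value [- q v] at [- v]. *)
Definition slope q v w n := q (w + v *+ n) - n%:R * q v.

Lemma slope_ge q v w n : sublinear q -> - q (- w) <= slope q v w n.
Proof.
move=> sq; have := sq.1 (w + v *+ n) (- w).
by rewrite addrAC subrr add0r sublinearMn// /slope; lra.
Qed.

Lemma slope_nincr q v w m n : sublinear q -> (m <= n)%N ->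
  slope q v w n <= slope q v w m.
Proof.
move=> sq mn; have := sq.1 (w + v *+ m) (v *+ (n - m)).
rewrite -addrA -mulrnDr subnKC// sublinearMn// /slope natrB//; lra.
Qed.

Definition tilt q v w := inf (range (slope q v w)).

Lemma tilt_le q v w n : sublinear q -> tilt q v w <= slope q v w n.
Proof.
move=> sq; apply: ge_inf; last by exists n.
by exists (- q (- w)) => _ [k _ <-]; exact: slope_ge.
Qed.

Lemma le_tilt q v w c : (forall n, c <= slope q v w n) -> c <= tilt q v w.
Proof.
by move=> cq; apply: lb_le_inf; [exists (slope q v w 0%N); exists 0%N|
  move=> _ [k _ <-]].
Qed.

(** Superhomogeneity uses that the slopes decrease: the infimum may be taken
    along the multiples of [n.+1], where homogeneity of [q] applies. *)
Lemma tilt_sublinear q v : sublinear q -> sublinear (tilt q v).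
Proof.
move=> sq; split=> [u w|w n].
- rewrite -lerBlDr; apply: le_tilt => m.
  rewrite lerBlDr -lerBlDl; apply: le_tilt => n; rewrite lerBlDl.
  apply: (le_trans (@tilt_le _ _ _ (m + n)%N sq)).
  rewrite /slope mulrnDr addrACA natrD mulrDl.
  by have := sq.1 (u + v *+ m) (w + v *+ n); lra.
- case: n => [|n]; first by rewrite mul0r; apply: le_tilt => k;
    rewrite /slope mulr0n add0r sublinearMn// subrr.
  apply: le_tilt => k.
  apply: (le_trans _ (@slope_nincr _ _ _ k (k * n.+1)%N sq _)).
    rewrite /slope mulrnA -mulrnDl sublinearMn// natrM (mulrC k%:R).
    by rewrite -mulrA -mulrBr ler_pM2l ?ltr0n// tilt_le.
  by rewrite leq_pmulr.
Qed.

Lemma tilt_le_self q v w : sublinear q -> tilt q v w <= q w.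
Proof.
move=> sq; apply: (le_trans (@tilt_le _ _ _ 0%N sq)).
by rewrite /slope mulr0n addr0 mul0r subr0.
Qed.

(** In a chain the smaller of two functionals serves for both summands, which
    keeps the infimum subadditive. *)
Lemma chain_inf_sublinear (A : set (V -> R)) q0 : A q0 ->
  (forall q, A q -> sublinear q) ->
  (forall q q', A q -> A q' ->
     (forall v, q v <= q' v) \/ (forall v, q' v <= q v)) ->
  (forall v, has_lbound [set q v | q in A]) ->
  sublinear (fun v => inf [set q v | q in A]).
Proof.
move=> Aq0 As Atot Alb.
have lb v q : A q -> inf [set q v | q in A] <= q v.
  by move=> Aq; apply: ge_inf => //; exists q.
have glb v c : (forall q, A q -> c <= q v) -> c <= inf [set q v | q in A].
  by move=> cq; apply: lb_le_inf; [exists (q0 v); exists q0|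
    move=> _ [q Aq <-]; exact: cq].
split=> [u v|v n].
- rewrite -lerBlDr; apply: (glb) => q Aq.
  rewrite lerBlDr -lerBlDl; apply: glb => q' Aq'; rewrite lerBlDl.
  have [qq'|q'q] := Atot _ _ Aq Aq'.
    by rewrite (le_trans (lb _ _ Aq))// (le_trans ((As _ Aq).1 _ _))// lerD2l.
  by rewrite (le_trans (lb _ _ Aq'))// (le_trans ((As _ Aq').1 _ _))// lerD2r.
- apply: glb => q Aq; apply: le_trans ((As _ Aq).2 _ _).
  by rewrite ler_wpM2l// lb.
Qed.

Lemma minimal_sublinear q : sublinear q ->
  exists q0, [/\ sublinear q0, forall v, q0 v <= q v &
    forall q1, sublinear q1 -> (forall v, q1 v <= q0 v) ->
      forall v, q0 v <= q1 v].
Proof.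
move=> sq.
pose T := {q0 : V -> R | sublinear q0 /\ forall v, q0 v <= q v}.
pose t0 : T := exist _ q (conj sq (fun v => lexx _)).
pose rT (s t : T) := `[< forall v, projT1 t v <= projT1 s v >].
have [||A tA|t tmin] := @ZL_preorder T t0 rT.
- by move=> s; apply/asboolP => v.
- move=> s t u /asboolP st /asboolP tu; apply/asboolP => v.
  exact: le_trans (tu v) (st v).
- have [[s0 As0]|A0] := pselect (exists s, A s); last first.
    by exists t0 => s As; exfalso; apply: A0; exists s.
  pose B : set (V -> R) := [set projT1 s | s in A].
  have Bs q1 : B q1 -> sublinear q1 /\ forall v, q1 v <= q v.
    by move=> [s _ <-]; exact: projT2 s.
  have Blb v : has_lbound [set q1 v | q1 in B].
    exists (- q (- v)) => _ [q1 /Bs[sq1 q1q] <-].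
    have := sq1.1 v (- v); rewrite subrr sublinear0//.
    have := q1q (- v); lra.
  have Bq0 : B (projT1 s0) by exists s0.
  have sB : sublinear (fun v => inf [set q1 v | q1 in B]).
    apply: (chain_inf_sublinear Bq0) => //; first by move=> q1 /Bs[].
    move=> _ _ [s As <-] [t At <-].
    by have [/asboolP|/asboolP] := tA _ _ As At; [right|left].
  have ltB s v : A s -> inf [set q1 v | q1 in B] <= projT1 s v.
    by move=> As; apply: ge_inf => //; exists (projT1 s) => //; exists s.
  have leB v : inf [set q1 v | q1 in B] <= q v.
    exact: le_trans (ltB _ _ As0) ((projT2 s0).2 v).
  pose tB : T := exist (fun q0 => sublinear q0 /\ forall v, q0 v <= q v)
    (fun v => inf [set q1 v | q1 in B]) (conj sB leB).
  exists tB => s As; apply/asboolP => v /=.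
  exact: ltB.
- exists (projT1 t); split; [exact: (projT2 t).1|exact: (projT2 t).2|].
  move=> q1 sq1 q1t.
  have leq1 v : q1 v <= q v by apply: le_trans (q1t v) ((projT2 t).2 v).
  pose t1 : T := exist (fun q0 => sublinear q0 /\ forall v, q0 v <= q v)
    q1 (conj sq1 leq1).
  have /asboolP := tmin t1 (introT (asboolP _) q1t).
  exact.
Qed.

(** A minimal sublinear functional coincides with all its tilts, and this is
    additivity.  Starting from the tilt of [q] along [v0] forces the value at
    [- v0], hence at [v0]. *)
Theorem hahn_banach q v0 : sublinear q -> exists L : V -> R,
  [/\ forall u v, L (u + v) = L u + L v, forall v, L v <= q v & L v0 = q v0].
Proof.
move=> sq; have stq := tilt_sublinear v0 sq.
have [L [sL Lt Lmin]] := minimal_sublinear stq.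
have Ltilt v w : L w = tilt L v w.
  apply/eqP; rewrite eq_le tilt_le_self// andbT.
  by apply: Lmin; [exact: tilt_sublinear|move=> u; exact: tilt_le_self].
have LD u v : L (u + v) = L u + L v.
  apply/eqP; rewrite eq_le sL.1/=.
  rewrite -lerBrDr (Ltilt v u); apply: (le_trans (@tilt_le _ _ _ 1%N sL)).
  by rewrite /slope mul1r.
have Lq v : L v <= q v := le_trans (Lt v) (tilt_le_self v0 v sq).
exists L; split=> //; apply/eqP; rewrite eq_le Lq/=.
have := LD v0 (- v0); rewrite subrr sublinear0//.
have := le_trans (Lt (- v0)) (@tilt_le q v0 (- v0) 1%N sq).
rewrite /slope mulr1n addNr mul1r sublinear0//; lra.
Qed.

End hahn_banach.

(** * Finite products of topological spaces *)

Section product_topology_facts.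
Variables (I : finType) (X : I -> topologicalType).
Implicit Types x y : prod_topology X.

Definition box (V : forall i, set (X i)) : set (prod_topology X) :=
  [set y | forall i, V i (y i)].

(** The filter generated by boxes converges to [x] coordinatewise, hence in the
    product topology. *)
Lemma nbhs_box x (U : set (prod_topology X)) : nbhs x U ->
  exists2 V : forall i, set (X i),
    forall i, open_nbhs (x i) (V i) & box V `<=` U.
Proof.
pose B := [set V : forall i, set (X i) | forall i, open_nbhs (x i) (V i)].
suff /[apply] [[V BV VU]] : filter_from B box --> x by exists V.
have FB : Filter (filter_from B box).
  apply: filter_from_filter.
    by exists (fun=> setT) => i; split=> //; exact: openT.
  move=> V W BV BW; exists (fun i => V i `&` W i) => [i|y VWy].
    by apply: open_nbhsI; [exact: BV|exact: BW].
  by split=> i; have [] := VWy i.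
apply/cvg_sup => i U' [_ [[W oW <-] Wx WU]].
apply: filterS WU _; exists (dfwith (fun=> setT) i W) => [j|y].
  by case: dfwithP => [//|k _]; split=> //; exact: openT.
by move=> /(_ i); rewrite dfwithin.
Qed.

Lemma box_open (V : forall i, set (X i)) :
  (forall i, open (V i)) -> open (box V).
Proof.
move=> oV; rewrite openE => y Vy.
apply: (@filter_forall _ _
  (fun i => [set z : prod_topology X | V i (z i)]) (nbhs y)) => i.
apply: (@proj_continuous I X i y); apply: open_nbhs_nbhs.
by split=> //; exact: Vy.
Qed.

Lemma prod_locally_compact : (forall i, locally_compact [set: X i]) ->
  (forall i, hausdorff_space (X i)) ->
  locally_compact [set: prod_topology X].
Proof.
move=> lX hX x _.
have lXx i : exists C : set (X i), nbhs (x i) C /\ compact C.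
  by have [C + [? _]] := lX i (x i) Logic.I; rewrite withinET; exists C.
pose C i := projT1 (cid (lXx i)).
have Cx i : nbhs (x i) (C i) /\ compact (C i) := projT2 (cid (lXx i)).
rewrite withinET; exists (box C).
  suff : nbhs x (box (fun i => (C i)°)).
    by apply: filterS => y Cy i; exact: interior_subset (Cy i).
  apply: open_nbhs_nbhs; split=> [|i]; last exact: (Cx i).1.
  by apply: box_open => i; exact: open_interior.
have cC : compact (box C) by apply: tychonoff => i; exact: (Cx i).2.
split=> //; apply: (compact_closed _ cC).
exact: (@hausdorff_product I X).
Qed.

End product_topology_facts.

Lemma compact_nbhs_compact (Y : ptopologicalType) (K : set Y) :
  locally_compact [set: Y] -> compact K ->
  exists V C, [/\ open V, compact C, K `<=` V & V `<=` C].
Proof.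
move=> lY; rewrite {1}compact_cover => cK.
have lYx (x : Y) : exists C : set Y, nbhs x C /\ compact C.
  by have [C + [? _]] := lY x Logic.I; rewrite withinET; exists C.
have [C Cx] := choice lYx.
have [||D _ KD] := cK Y setT (fun x => (C x)°).
- by move=> x _; exact: open_interior.
- by move=> x Kx; exists x => //; exact: (Cx x).1.
exists (\bigcup_(x in [set` D]) (C x)°), (\bigcup_(x in [set` D]) C x).
split=> //.
- by apply: bigcup_open => x _; exact: open_interior.
- rewrite bigcup_fset; apply: bigsetU_compact => x _; exact: (Cx x).2.
- by apply: subset_bigcup => x _; exact: interior_subset.
Qed.

Section coordinate_restriction.
Variables (d : nat) (X : 'I_d -> ptopologicalType).

Lemma restr_continuous (S : {set 'I_d}) : continuous (@restr d X S).
Proof.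
move=> x; apply/cvg_sup => j U [_ [[W oW <-] Wx WU]].
apply: filterS WU _; rewrite /= nbhs_simpl /=.
by apply: (@proj_continuous _ X (val j) x); exact: open_nbhs_nbhs.
Qed.

Lemma restr_surj (S : {set 'I_d}) (y : sub_space X S) :
  exists x, @restr d X S x = y.
Proof.
exists (fun j => match pselect (j \in S) return X j with
  | left jS => y (exist _ j jS)
  | right _ => point
  end).
apply: functional_extensionality_dep => -[j jS]; rewrite /restr /=.
case: pselect => [jS'|/(_ jS)//].
exact: (f_equal (fun h : j \in S => y (exist _ j h) : X j)
  (bool_irrelevance jS' jS)).
Qed.

(** Sigma-compactness of open sets descends along the continuous surjection
    [restr]. *)
Lemma sub_space_sigma_compact (S : {set 'I_d}) :
  (forall U : set (full_space X), open U -> sigma_compact U) ->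
  forall U : set (sub_space X S), open U -> sigma_compact U.
Proof.
move=> scX U oU.
have [|K cK UK] := scX (@restr d X S @^-1` U).
  by apply: open_comp => // x _; exact: restr_continuous.
exists (fun n => @restr d X S @` K n) => [n|].
  apply: continuous_compact (cK n); apply: continuous_subspaceT.
  exact: restr_continuous.
rewrite -image_bigcup -UK image_preimage//.
by apply/seteqP; split=> // y _; have [x <-] := restr_surj y; exists x.
Qed.

End coordinate_restriction.

(** * Regularity and tightness of Borel probability measures *)

(** Continuity from above of a finite measure, in the form used to cut
    countable unions of closed or compact sets down to finite ones. *)
Lemma bigcup_tail_small (d : measure_display) (T : measurableType d)
    (R : realType) (P : probability T R) (F : (set T)^nat) (e : R) : 0 < e ->
  (forall n, measurable (F n)) ->
  exists N, (P (\bigcup_n F n `\` \big[setU/set0]_(i < N) F i) <= e%:E)%E.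
Proof.
move=> e0 mF; pose G n := \bigcup_n F n `\` \big[setU/set0]_(i < n) F i.
have mU : measurable (\bigcup_n F n) by exact: bigcupT_measurable.
have mG n : measurable (G n).
  by apply: measurableD => //; exact: bigsetU_measurable.
have G0 : \bigcap_n G n = set0.
  apply/seteqP; split=> // x Gx; have [[n _ Fx] _] := Gx 0%N Logic.I.
  have [_] := Gx n.+1 Logic.I; apply.
  by rewrite big_ord_recr /=; right.
have Pfin A : measurable A -> P A \is a fin_num.
  by move=> mA; exact: fin_num_measure.
have := @nonincreasing_cvg_mu _ _ _ P G; rewrite G0 measure0 => cG.
have {}cG : P \o G @ \oo --> 0%:E.
  apply: cG => //; first by rewrite ltey_eq Pfin.
  move=> m n mn; apply/subsetPset; apply: setDS.
  exact: subset_bigsetU.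
have /fine_cvgP[_ /cvgr_lt /(_ _ e0)[N _ NG]] := cG.
exists N; have /= := NG N (leqnn N).
by rewrite -lte_fin fineK ?Pfin// => /ltW.
Qed.

Section borel_regularity.
Variables (R : realType) (Y : ptopologicalType).
Hypotheses (Y_T2 : hausdorff_space Y)
  (Y_sc : forall U : set Y, open U -> sigma_compact U).
Variable P : probability (borel Y) R.

Lemma measurable_open (U : set Y) : open U -> measurable (U : set (borel Y)).
Proof. exact: sub_sigma_algebra. Qed.

Lemma measurable_closed (F : set Y) :
  closed F -> measurable (F : set (borel Y)).
Proof.
move=> cF; rewrite -[F]setCK; apply: measurableC.
by apply: measurable_open; exact: closed_openC.
Qed.

(** The regularity notion is symmetric under complement, so that regular sets
    form a sigma-algebra; sigma-compactness makes the open sets regular. *)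
Definition closed_open_regular (A : set Y) := forall e : R, 0 < e ->
  exists F U : set Y, [/\ closed F, open U, F `<=` A, A `<=` U &
    (P (U `\` F : set (borel Y)) <= e%:E)%E].

Lemma open_regular (U : set Y) : open U -> closed_open_regular U.
Proof.
move=> oU e e0; have [K cK UK] := Y_sc oU.
have clK n : closed (K n) by exact: compact_closed.
have mK n : measurable (K n : set (borel Y)) by exact: measurable_closed.
have [N NP] := bigcup_tail_small P e0 mK.
exists (\big[setU/set0]_(i < N) K i), U; split => //.
- by rewrite -bigcup_mkord; apply: closed_bigcup.
- by rewrite UK; apply: bigsetU_bigcup.
- by rewrite UK.
Qed.

Lemma regularC (A : set Y) :
  closed_open_regular A -> closed_open_regular (~` A).
Proof.
move=> rA e /rA[F [U [cF oU FA AU PUF]]]; exists (~` U), (~` F); split=> //.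
- exact: open_closedC.
- exact: closed_openC.
- exact: subsetC.
- exact: subsetC.
- by rewrite setDE setCK setIC -setDE.
Qed.

Lemma regular_bigcup (A : (set Y)^nat) :
  (forall n, closed_open_regular (A n)) -> closed_open_regular (\bigcup_n A n).
Proof.
move=> rA e e0; have e20 : 0 < e / 2 by rewrite divr_gt0.
have rAn n : exists FU : set Y * set Y,
    [/\ closed FU.1, open FU.2, FU.1 `<=` A n, A n `<=` FU.2 &
    (P (FU.2 `\` FU.1 : set (borel Y)) <= (e / 2 / (2 ^ n.+1)%:R)%:E)%E].
  have [|F [U ?]] := rA n (e / 2 / (2 ^ n.+1)%:R); last by exists (F, U).
  by rewrite divr_gt0// ltr0n expn_gt0.
have [FU hFU] := choice rAn; pose F n := (FU n).1; pose U n := (FU n).2.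
have mF n : measurable (F n : set (borel Y)).
  by apply: measurable_closed; case: (hFU n).
have mU n : measurable (U n : set (borel Y)).
  by apply: measurable_open; case: (hFU n).
have [N NP] := bigcup_tail_small P e20 mF.
exists (\big[setU/set0]_(i < N) F i), (\bigcup_n U n); split.
- by rewrite -bigcup_mkord; apply: closed_bigcup => // i _; case: (hFU i).
- by apply: bigcup_open => n _; case: (hFU n).
- move=> x /(@bigsetU_bigcup _ F N)[n _ Fx]; exists n => //.
  by case: (hFU n) => _ _ /(_ _ Fx).
- by apply: subset_bigcup => n _; case: (hFU n).
- have mUF n : measurable ((U n `\` F n) : set (borel Y)).
    exact: measurableD.
  apply: (@le_trans _ _ (P (\bigcup_n (U n `\` F n)) +
      P (\bigcup_n F n `\` \big[setU/set0]_(i < N) F i))%E).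
    apply: (@le_trans _ _ (P (\bigcup_n (U n `\` F n) `|`
       (\bigcup_n F n `\` \big[setU/set0]_(i < N) F i)))).
      apply: le_measure; rewrite ?inE.
      + apply: measurableD; first exact: bigcupT_measurable.
        exact: bigsetU_measurable.
      + apply: measurableU; first exact: bigcupT_measurable.
        apply: measurableD; first exact: bigcupT_measurable.
        exact: bigsetU_measurable.
      + move=> x [[n _ Ux] Fx].
        have [Fnx|nFx] := pselect ((\bigcup_n F n) x); [by right|left].
        by exists n => //; split=> // Fnx; apply: nFx; exists n.
    apply: measureU2; first exact: bigcupT_measurable.
    apply: measurableD; first exact: bigcupT_measurable.
    exact: bigsetU_measurable.
  rewrite [e]splitr EFinD; apply: leeD => //.
  apply: (@le_trans _ _ (\sum_(n <oo) (0 + (e / 2 / (2 ^ n.+1)%:R)%:E))%E).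
    apply: (@le_trans _ _ (\sum_(n <oo) P (U n `\` F n))%E).
      apply: measure_sigma_subadditive => //; exact: bigcupT_measurable.
    by apply: lee_nneseries => // n _; rewrite add0e; case: (hFU n).
  have := @epsilon_trick R (fun=> 0%E) (e / 2) xpredT (fun=> lexx _) (ltW e20).
  by rewrite [X in (_ <= X + _)%E -> _]eseries0// add0e.
Qed.

Lemma borel_regular (A : set (borel Y)) : measurable A -> closed_open_regular A.
Proof.
apply: (smallest_sub _ open_regular); split.
- by apply: open_regular; exact: open0.
- by move=> B rB; rewrite setTD; exact: regularC.
- exact: regular_bigcup.
Qed.

(** Local compactness thickens a countable compact cover to open sets with
    compact hulls; finitely many of them carry almost all the mass.  The open
    set inside the compact one is what makes the indicator of the complement
    upper semicontinuous later on. *)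
Lemma borel_tight : locally_compact [set: Y] -> forall e : R, 0 < e ->
  exists V K : set Y, [/\ open V, compact K, V `<=` K &
    (P (~` V : set (borel Y)) <= e%:E)%E].
Proof.
move=> lY e e0; have [K cK YK] := Y_sc openT.
have nK n : exists VC : set Y * set Y,
    [/\ open VC.1, compact VC.2, K n `<=` VC.1 & VC.1 `<=` VC.2].
  by have [V [C ?]] := compact_nbhs_compact lY (cK n); exists (V, C).
have [VC hVC] := choice nK; pose V n := (VC n).1; pose C n := (VC n).2.
have mV n : measurable (V n : set (borel Y)).
  by apply: measurable_open; case: (hVC n).
have [N NP] := bigcup_tail_small P e0 mV.
exists (\big[setU/set0]_(i < N) V i), (\big[setU/set0]_(i < N) C i); split.
- by rewrite -bigcup_mkord; apply: bigcup_open => i _; case: (hVC i).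
- by apply: bigsetU_compact => i _; case: (hVC i).
- rewrite -!bigcup_mkord; apply: subset_bigcup => i _; by case: (hVC i).
- suff VT : \bigcup_n V n = setT by rewrite -setTD -VT.
  apply/seteqP; split=> // y _.
  have [n _ Kny] : (\bigcup_n K n) y by rewrite -YK.
  by exists n => //; case: (hVC n) => _ _ + _; exact.
Qed.

End borel_regularity.

(** * From finitely additive charges to Borel measures *)

Lemma compact_cover_seq (Y : ptopologicalType) (K : set Y) (U : (set Y)^nat) :
  compact K -> (forall n, open (U n)) -> K `<=` \bigcup_n U n ->
  exists N, K `<=` \big[setU/set0]_(i < N) U i.
Proof.
rewrite {1}compact_cover => cK oU KU.
have [D _ KD] := cK nat setT U (fun n _ => oU n) KU.
exists (\max_(i <- D) i).+1 => x /KD[n /= nD Unx].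
by rewrite -bigcup_mkord; exists n => //=; rewrite ltnS leq_bigmax_seq.
Qed.

Record charge (R : realType) (Y : Type) := Charge {
  charge_fun :> set Y -> R;
  charge_ge0 : forall A, 0 <= charge_fun A;
  chargeU : forall A B, A `&` B = set0 ->
    charge_fun (A `|` B) = charge_fun A + charge_fun B }.

Section charge_theory.
Variables (R : realType) (Y : Type) (m : charge R Y).
Implicit Types A B : set Y.

Lemma charge0 : m set0 = 0.
Proof. by have := chargeU m (setI0 set0); rewrite setU0; lra. Qed.

Lemma le_charge A B : A `<=` B -> m A <= m B.
Proof.
move=> AB; have AB0 : A `&` (B `\` A) = set0 by rewrite setDIK.
have := chargeU m AB0.
have := charge_ge0 m (B `\` A).
by rewrite setDUK//; lra.
Qed.

Lemma charge_le_U A B : m (A `|` B) <= m A + m B.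
Proof.
have -> : A `|` B = A `|` (B `\` A).
  apply/seteqP; split=> x [Ax|]; [by left| |by left|by case; right].
  by move=> Bx; have [Ax|Ax] := pselect (A x); [left|right].
rewrite chargeU; last by rewrite setDIK.
by rewrite lerD2l le_charge.
Qed.

Lemma charge_le_bigU (I : Type) (s : seq I) (A : I -> set Y) :
  m (\big[setU/set0]_(i <- s) A i) <= \sum_(i <- s) m (A i).
Proof.
elim: s => [|i s IHs]; first by rewrite !big_nil charge0.
by rewrite !big_cons (le_trans (charge_le_U _ _))// lerD2l.
Qed.

End charge_theory.

Record tight_charge (R : realType) (Y : topologicalType) := TightCharge {
  tight_charge_val :> charge R Y;
  charge_tight : forall e : R, 0 < e ->
    exists K, [/\ compact K, closed K & tight_charge_val (~` K) <= e] }.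

Section regular_sets.
Variables (R : realType) (Y : ptopologicalType) (m : tight_charge R Y).
Implicit Types A B : set Y.

(** Unlike regularity of measures, the inner approximation is by compact sets:
    finite subcovers are the only source of countable additivity here. *)
Definition charge_regular A := forall e : R, 0 < e ->
  exists K U, [/\ compact K, closed K, open U, K `<=` A /\ A `<=` U &
    m (U `\` K) <= e].

Lemma charge_regular0 : charge_regular set0.
Proof.
move=> e e0; exists set0, set0; split=> //.
- exact: compact0.
- exact: closed0.
- exact: open0.
- by split.
- by rewrite set0D charge0 ltW.
Qed.

Lemma charge_regularU : setU_closed charge_regular.
Proof.
move=> A B rA rB e e0; have e20 : 0 < e / 2 by rewrite divr_gt0.
have [K [U [cK clK oU [KA AU] mA]]] := rA _ e20.
have [L [V [cL clL oV [LB BV] mB]]] := rB _ e20.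
exists (K `|` L), (U `|` V); split.
- exact: compactU.
- exact: closedU.
- exact: openU.
- by split; exact: setUSS.
- rewrite [e]splitr (le_trans _ (lerD mA mB))//.
  rewrite (le_trans _ (charge_le_U _ _ _))//.
  by apply: le_charge => x [[Ux|Vx] nKL]; [left|right]; split=> // ?;
    apply: nKL; [left|right].
Qed.

(** Tightness is needed because the complement of an open set is only closed;
    intersecting it with a large compact set costs little. *)
Lemma charge_regularC : setC_closed charge_regular.
Proof.
move=> A rA e e0; have e20 : 0 < e / 2 by rewrite divr_gt0.
have [K [U [cK clK oU [KA AU] mA]]] := rA _ e20.
have [L [cL clL mL]] := charge_tight m e20.
exists (~` U `&` L), (~` K); split.
- by rewrite setIC; apply: compact_closedI => //; exact: open_closedC.
- by apply: closedI => //; exact: open_closedC.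
- exact: closed_openC.
- by split; [move=> x [Ux _] /AU|exact: subsetC].
- rewrite [e]splitr (le_trans _ (lerD mA mL))//.
  rewrite (le_trans _ (charge_le_U _ _ _))//.
  apply: le_charge => x [Kx UL].
  have [Lx|] := pselect (L x); [left; split=> //|by right].
  by apply: contrapT => Ux; apply: UL.
Qed.

Lemma charge_regularI : setI_closed charge_regular.
Proof.
move=> A B rA rB; rewrite -[A `&` B]setCK setCI.
by apply: charge_regularC; apply: charge_regularU; exact: charge_regularC.
Qed.

Lemma charge_regularT : charge_regular setT.
Proof. by rewrite -setC0; apply: charge_regularC; exact: charge_regular0. Qed.

(** A compact subset that carries almost all of [A] is covered by finitely many
    of the open hulls of the [F n], and finite subadditivity suffices. *)
Lemma charge_sigma_subadditive A (F : (set Y)^nat) :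
  charge_regular A -> (forall n, charge_regular (F n)) ->
  A `<=` \bigcup_n F n -> ((m A)%:E <= \sum_(n <oo) (m (F n))%:E)%E.
Proof.
move=> rA rF AF; apply/lee_addgt0Pr => e e0.
have e20 : 0 < e / 2 by rewrite divr_gt0.
have [K [V [cK _ _ [KA AV] mK]]] := rA _ e20.
have rFn n : exists U, [/\ open U, F n `<=` U &
    m U <= m (F n) + e / 2 / (2 ^ n.+1)%:R].
  have [|L [U [_ _ oU [LF FU] mU]]] := rF n (e / 2 / (2 ^ n.+1)%:R).
    by rewrite divr_gt0// ltr0n expn_gt0.
  exists U; split=> //.
  apply: (le_trans _ (lerD (le_charge m LF) mU)).
  apply: le_trans (charge_le_U _ _ _); apply: le_charge => x Ux.
  by have [Lx|nLx] := pselect (L x); [left|right].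
have [U hU] := choice rFn.
have [||N KN] := compact_cover_seq (U := U) cK.
- by move=> n; case: (hU n).
- by move=> x /KA/AF[n _ Fx]; exists n => //; case: (hU n) => _ + _; exact.
have mA : m A <= e / 2 + \sum_(i < N) (m (F i) + e / 2 / (2 ^ i.+1)%:R).
  apply: (@le_trans _ _ (m (A `\` K) + m (\big[setU/set0]_(i < N) U i))).
    apply: le_trans (charge_le_U _ _ _); apply: le_charge => x Ax.
    by have [Kx|Kx] := pselect (K x); [right; exact: KN|left].
  apply: lerD.
    by apply: le_trans mK; apply: le_charge; exact: setSD.
  apply: (le_trans (charge_le_bigU _ _ _)).
  by apply: ler_sum => i _; case: (hU i).
apply: (@le_trans _ _ ((e / 2)%:E +
    \sum_(n <oo) ((m (F n))%:E + (e / 2 / (2 ^ n.+1)%:R)%:E)))%E.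
  apply: (@le_trans _ _ (e / 2 +
      \sum_(i < N) (m (F i) + e / 2 / (2 ^ i.+1)%:R))%:E) => //.
  rewrite EFinD leeD2l// -sumEFin.
  rewrite -(big_mkord xpredT
    (fun i => (m (F i) + e / 2 / (2 ^ i.+1)%:R)%:E)).
  apply: nneseries_lim_ge => n _ _.
  by rewrite lee_fin addr_ge0 ?charge_ge0// divr_ge0// ltW.
rewrite [in leRHS](splitr e) EFinD addeA [in leRHS]addeC leeD2l//.
apply: epsilon_trick; last exact: ltW.
by move=> n; rewrite lee_fin charge_ge0.
Qed.

End regular_sets.

Lemma image_measure (d1 d2 : measure_display) (T1 : measurableType d1)
    (T2 : measurableType d2) (R : realType) (nu : {measure set T1 -> \bar R})
    (f : T1 -> T2) : measurable_fun setT f ->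
  exists m : {measure set T2 -> \bar R}, forall A, m A = nu (f @^-1` A).
Proof.
move=> mf; exists (pushforward nu f) => //.
Unshelve. exact: mf.
Qed.

(** A copy of [Y] whose measurable sets are the regular sets of [m]; the algebra
    depends on the charge. *)
Definition charged (R : realType) (Y : ptopologicalType)
  (m : tight_charge R Y) : Type := Y.

Section extension.
Variables (R : realType) (Y : ptopologicalType) (m : tight_charge R Y).

HB.instance Definition _ := Pointed.on (charged m).
HB.instance Definition _ := @isAlgebraOfSets.Build default_measure_display
  (charged m) (charge_regular m) (charge_regular0 m)
  (@charge_regularU R Y m) (@charge_regularC R Y m).

Definition regular_charge (A : set (charged m)) : \bar R := (m A)%:E.

Let regular_charge_ge0 A : (0 <= regular_charge A)%E.
Proof. by rewrite lee_fin charge_ge0. Qed.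

Let regular_charge_additive : measure_function.semi_additive regular_charge.
Proof.
apply/additive2P; first by rewrite /regular_charge charge0.
by move=> A B _ _ AB0; rewrite /regular_charge chargeU.
Qed.

HB.instance Definition _ := isContent.Build default_measure_display
  (charged m) R regular_charge regular_charge_ge0 regular_charge_additive.

Let regular_charge_sigma_subadditive :
  measurable_subset_sigma_subadditive regular_charge.
Proof. by move=> A F rF rA AF; exact: charge_sigma_subadditive. Qed.

HB.instance Definition _ := Content_SigmaSubAdditive_isMeasure.Build
  default_measure_display R (charged m) regular_charge
  regular_charge_sigma_subadditive.

Let sT : measurableType _ := g_sigma_algebraType (@measurable _ (charged m)).

(** Finitely many regular neighborhoods inside [U] cover a compact piece of
    [U], so [U] is a countable union of regular sets. *)
Lemma open_charge_measurable (U : set Y) : sigma_compact U ->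
  (forall x, U x ->
     exists V, [/\ open V, V x, V `<=` U & charge_regular m V]) ->
  measurable (U : set sT).
Proof.
move=> [K cK UK] baseU.
have baseU' x : exists V, U x ->
    [/\ open V, V x, V `<=` U & charge_regular m V].
  by have [/baseU[V]|nUx] := pselect (U x); [exists V|exists set0].
have [V hV] := choice baseU'.
have KA n : exists A, [/\ K n `<=` A, A `<=` U & charge_regular m A].
  have := cK n; rewrite compact_cover => /(_ Y U V)[||D DU KD].
  - by move=> x /hV[].
  - move=> x Kx; have Ux : U x by rewrite UK; exists n.
    by exists x => //; case: (hV x Ux).
  exists (\bigcup_(x in [set` D]) V x); split=> //.
    move=> x [y /= yD]; have := DU _ yD; rewrite inE => /hV[_ _ + _]; exact.
  rewrite bigcup_fset big_seq; elim/big_ind: _.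
  - exact: charge_regular0.
  - exact: charge_regularU.
  - by move=> y yD; have := DU _ yD; rewrite inE => /hV[].
have [A hA] := choice KA.
have -> : U = \bigcup_n A n.
  apply/seteqP; split=> [x|x [n _]]; last by case: (hA n) => _ + _; exact.
  by rewrite {1}UK => -[n _ Kx]; exists n => //; case: (hA n) => + _ _; exact.
apply: (@bigcupT_measurable _ sT) => n.
by apply: sub_sigma_algebra; case: (hA n).
Qed.

Theorem charge_extension :
  (forall U : set Y, open U -> sigma_compact U) ->
  (forall (U : set Y) x, open U -> U x ->
     exists V, [/\ open V, V x, V `<=` U & charge_regular m V]) ->
  exists nu : {measure set (borel Y) -> \bar R},
    forall A : set Y, charge_regular m A -> nu A = (m A)%:E.
Proof.
move=> scY baseY.
have mid : measurable_fun setT (id : sT -> borel Y).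
  apply: (@measurability _ _ sT (borel Y) setT _ (@open Y)) => //.
  move=> _ [U oU <-]; rewrite setTI preimage_id.
  by apply: open_charge_measurable; [exact: scY|move=> x; exact: baseY].
have [nu nuE] := image_measure (measure_extension regular_charge) mid.
exists nu => A rA; rewrite nuE /= /measure_extension.
by rewrite measurable_mu_extE.
Qed.

End extension.

(** * Semicontinuous functions *)

Section semicontinuity.
Variables (R : realType) (Y : ptopologicalType).
Implicit Types f g : Y -> R.

Lemma bounded_funP f : bounded_fun f <-> exists M, forall x, `|f x| <= M.
Proof.
split=> [[M [_ fM]]|[M fM]].
  by exists (M + 1) => x; apply: fM => //; rewrite ltrDl.
exists M; split; first exact: num_real.
by move=> N MN x _; exact: le_trans (fM x) (ltW MN).
Qed.

Definition lsc f := forall x a, a < f x -> \forall y \near x, a < f y.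

Lemma lsc_open f a : lsc f -> open [set x | a < f x].
Proof. by move=> lf; rewrite openE => x /= /lf. Qed.

Lemma lsc_measurable f : lsc f -> measurable_fun [set: borel Y] f.
Proof.
move=> lf; apply: (measurability _ (RGenOInfty.measurableE R)).
move=> /= _ [_ [a ->]] <-; rewrite setTI preimage_itvoy.
by apply: measurable_open; exact: lsc_open.
Qed.

Lemma lscN f : upper_semicontinuous f -> lsc (fun x => - f x).
Proof.
move=> uf x a; rewrite ltrNr => /uf; apply: filterS => y.
by rewrite ltrNr.
Qed.

Lemma usc_measurable f : upper_semicontinuous f ->
  measurable_fun [set: borel Y] f.
Proof.
move=> /lscN/lsc_measurable mf.
rewrite (_ : f = (fun x => - (- f x))); last first.
  by apply/funext => x; rewrite opprK.
exact: measurableT_comp.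
Qed.

Lemma lsc_cst c : lsc (cst c).
Proof. by move=> x a ac; apply: nearW. Qed.

Lemma lscD f g : lsc f -> lsc g -> lsc (f \+ g).
Proof.
move=> lf lg x a /= afg; pose e := (f x + g x - a) / 2.
have e0 : 0 < e by rewrite divr_gt0// subr_gt0.
have := lf x (f x - e); have := lg x (g x - e).
rewrite !ltrBlDr !ltrDl => /(_ e0) nf /(_ e0) ng.
near=> y.
have -> : a = (f x - e) + (g x - e) by rewrite /e; lra.
by apply: ltrD; near: y.
Unshelve. all: by end_near. Qed.

Lemma lscZ c f : 0 <= c -> lsc f -> lsc (c \*o f).
Proof.
rewrite le_eqVlt => /predU1P[<- _|c0 lf] x a /=.
  by rewrite mul0r => a0; apply: nearW => y; rewrite mul0r.
rewrite -ltr_pdivrMl// => /lf; apply: filterS => y.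
by rewrite ltr_pdivrMl.
Qed.

Lemma lsc_indic (U : set Y) : open U -> lsc (\1_U : Y -> R).
Proof.
move=> oU x a; rewrite !indicE; case: (boolP (x \in U)) => xU a1.
  rewrite inE in xU; have : nbhs x U by exact: open_nbhs_nbhs.
  by apply: filterS => y Uy; rewrite indicE mem_set.
by apply: nearW => y; rewrite indicE (lt_le_trans a1)// ler0n.
Qed.

Lemma usc_cst c : upper_semicontinuous (cst c : Y -> R).
Proof. by move=> x a ac; apply: nearW. Qed.

Lemma uscD f g : upper_semicontinuous f -> upper_semicontinuous g ->
  upper_semicontinuous (f \+ g).
Proof.
move=> /lscN lf /lscN lg x a fga.
have := lscD lf lg; move=> /(_ x (- a)) /=; rewrite -opprD ltrN2 => /(_ fga).
by apply: filterS => y; rewrite -opprD ltrN2.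
Qed.

Lemma uscZ c f : 0 <= c -> upper_semicontinuous f ->
  upper_semicontinuous (c \*o f).
Proof.
move=> c0 /lscN lf x a fga.
have := lscZ c0 lf; move=> /(_ x (- a)) /=; rewrite mulrN ltrN2 => /(_ fga).
by apply: filterS => y; rewrite mulrN ltrN2.
Qed.

Lemma usc_indic (F : set Y) : closed F -> upper_semicontinuous (\1_F : Y -> R).
Proof.
move=> cF x a; rewrite !indicE; case: (boolP (x \in F)) => [|/negP] xF a1.
  by apply: nearW => y; rewrite indicE (le_lt_trans _ a1)// lern1 leq_b1.
have : nbhs x (~` F).
  apply: open_nbhs_nbhs; split; first exact: closed_openC.
  by move=> Fx; apply: xF; rewrite inE.
by apply: filterS => y nFy; rewrite indicE memNset.
Qed.

Lemma usc_max f g : upper_semicontinuous f -> upper_semicontinuous g ->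
  upper_semicontinuous (fun x => Num.max (f x) (g x)).
Proof.
move=> uf ug x a; rewrite gt_max => /andP[/uf nf /ug ng].
by near=> y; rewrite gt_max; apply/andP; split; near: y.
Unshelve. all: by end_near. Qed.

Lemma bounded_measurable_integrable (P : probability (borel Y) R) f :
  bounded_fun f -> measurable_fun [set: borel Y] f ->
  P.-integrable [set: borel Y] (EFin \o f).
Proof.
move=> bf mf; apply: measurable_bounded_integrable => //.
by rewrite -ge0_fin_numE// fin_num_measure.
Qed.

End semicontinuity.

(** * The price functional *)

Section pricing.
Variables (R : realType) (d : nat) (X : 'I_d -> ptopologicalType).
Variable SS : {set {set 'I_d}}.
Variable P : distributions R X SS.

Notation Y S := (sub_space X (val S)).
Notation restr_ S := (@restr d X (val S)).
Notation prices := (forall S : member SS, Y S -> R).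
Implicit Types (g h : prices) (S : member SS).
Implicit Types phi psi : {fimfun full_space X >-> R}.

Definition cost g := \sum_(S : member SS) \int[P S]_x g S x.

Definition total g (x : full_space X) := \sum_(S : member SS) g S (restr_ S x).

Definition lsc_prices g := forall S,
  [/\ bounded_fun (g S), lsc (g S) & forall y, 0 <= g S y].

Definition pinned (x : full_space X) :=
  forall j, (forall S, j \notin val S) -> x j = point.

Definition dominates g (phi : full_space X -> R) :=
  forall x, pinned x -> phi x <= total g x.

Lemma lsc_prices_integrable g S : lsc_prices g ->
  (P S).-integrable [set: borel (Y S)] (EFin \o g S).
Proof.
move=> /(_ S)[bg lg _]; apply: bounded_measurable_integrable => //.
exact: lsc_measurable.
Qed.

Lemma lsc_pricesD g h : lsc_prices g -> lsc_prices h ->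
  lsc_prices (fun S => g S \+ h S).
Proof.
move=> pg ph S; have [bg lg g0] := pg S; have [bh lh h0] := ph S.
split; [|exact: lscD|by move=> y; rewrite /= addr_ge0].
have /bounded_funP[M gM] := bg; have /bounded_funP[N hN] := bh.
apply/bounded_funP; exists (M + N) => x.
by rewrite (le_trans (ler_normD _ _))// lerD.
Qed.

Lemma lsc_pricesZ c g : 0 <= c -> lsc_prices g ->
  lsc_prices (fun S => c \*o g S).
Proof.
move=> c0 pg S; have [bg lg g0] := pg S.
split; [|exact: lscZ|by move=> y; rewrite /= mulr_ge0].
have /bounded_funP[M gM] := bg; apply/bounded_funP; exists (c * M) => x.
by rewrite normrM ger0_norm// ler_wpM2l.
Qed.

Lemma lsc_prices_cst c : 0 <= c -> lsc_prices (fun S => cst c).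
Proof.
move=> c0 S; split=> //; last exact: lsc_cst.
by apply/bounded_funP; exists `|c|.
Qed.

Lemma costD g h : lsc_prices g -> lsc_prices h ->
  cost (fun S => g S \+ h S) = cost g + cost h.
Proof.
move=> pg ph; rewrite /cost -big_split; apply: eq_bigr => S _ /=.
by rewrite RintegralD//; exact: lsc_prices_integrable.
Qed.

Lemma costZ c g : lsc_prices g -> cost (fun S => c \*o g S) = c * cost g.
Proof.
move=> pg; rewrite /cost mulr_sumr; apply: eq_bigr => S _ /=.
by rewrite RintegralZl//; exact: lsc_prices_integrable.
Qed.

Lemma cost_ge0 g : lsc_prices g -> 0 <= cost g.
Proof.
move=> pg; apply: sumr_ge0 => S _; apply: Rintegral_ge0 => y _.
by case: (pg S).
Qed.

(** The value of the dual problem for the target [phi].  Functions with finite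
    range are bounded, hence dominated by constant prices, and they include the
    indicators of all sets. *)
Definition price (phi : {fimfun full_space X >-> R}) : R :=
  inf [set cost g | g in [set g | lsc_prices g /\ dominates g phi]].

Lemma price_le g phi : lsc_prices g -> dominates g phi -> price phi <= cost g.
Proof.
move=> pg gphi; apply: ge_inf; last by exists g.
by exists 0 => _ [h [ph _] <-]; exact: cost_ge0.
Qed.

Hypothesis SS_neq0 : SS != finset.set0.

Lemma dominates_ex (phi : full_space X -> R) : bounded_fun phi ->
  exists2 g, lsc_prices g & dominates g phi.
Proof.
move=> /bounded_funP[M phiM].
have [S0 S0SS] : exists T : {set 'I_d}, T \in SS by apply/finset.set0Pn.
exists (fun S => cst `|M|); first exact: lsc_prices_cst.
move=> x _; rewrite /total (bigD1 (exist _ S0 S0SS : member SS))//= ler_wpDr//.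
  exact: sumr_ge0.
by rewrite (le_trans _ (ler_norm M))// (le_trans _ (phiM x))// ler_norm.
Qed.

Lemma fimfun_bounded (phi : {fimfun full_space X >-> R}) : bounded_fun phi.
Proof.
have := @fimfunP _ _ phi => /finite_fsetP[D phiD]; apply/bounded_funP.
exists (\sum_(v <- D) `|v|) => x.
have xD : phi x \in D.
  by have : (range phi) (phi x) by []; rewrite phiD.
by rewrite (big_fsetD1 (phi x))//= ler_wpDr// sumr_ge0.
Qed.

Lemma le_price phi c :
  (forall g, lsc_prices g -> dominates g phi -> c <= cost g) -> c <= price phi.
Proof.
move=> cg; have [g pg gphi] := dominates_ex (fimfun_bounded phi).
apply: lb_le_inf; first by exists (cost g); exists g.
by move=> _ [h [ph hphi] <-]; exact: cg.
Qed.

Lemma price_sublinear : sublinear price.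
Proof.
split=> [phi psi|phi n].
- rewrite -lerBlDr; apply: le_price => g pg gphi.
  rewrite lerBlDr -lerBlDl; apply: le_price => h ph hpsi; rewrite lerBlDl.
  rewrite -costD//; apply: price_le; first exact: lsc_pricesD.
  move=> x px; rewrite fimfunD /total big_split /=.
  by apply: lerD; [exact: gphi|exact: hpsi].
- apply: le_price => g pg gphi; case: n gphi => [|n] gphi.
    by rewrite mul0r; exact: cost_ge0.
  rewrite -ler_pdivlMl ?ltr0n// -costZ//; apply: price_le.
    by apply: lsc_pricesZ; rewrite // invr_ge0.
  move=> x /gphi; rewrite /total -mulr_sumr /=.
  rewrite -[X in _ -> _ <= _ * X]/(total g x).
  rewrite ler_pdivlMl ?ltr0n//; apply: le_trans.
  rewrite le_eqVlt; apply/orP; left; apply/eqP.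
  elim: n {gphi} => [|n IHn]; rewrite ?mul1r// mulrS fimfunD/= -IHn.
  by rewrite -natr1 mulrDl mul1r addrC.
Qed.

End pricing.

Section price_charge.
Variables (R : realType) (d : nat) (X : 'I_d -> ptopologicalType).
Variable SS : {set {set 'I_d}}.
Variable P : distributions R X SS.

Notation Y S := (sub_space X (val S)).
Notation restr_ S := (@restr d X (val S)).
Implicit Types (S : member SS).

Definition indic_prices S (U : set (Y S)) : forall S' : member SS, Y S' -> R :=
  dfwith (fun=> cst 0) S (\1_U : Y S -> R).

Lemma indic_prices_lsc S (U : set (Y S)) :
  open U -> lsc_prices (indic_prices U).
Proof.
move=> oU S'; rewrite /indic_prices; case: dfwithP => [|T _].
- split; [|exact: lsc_indic|by move=> y; rewrite indicE ler0n].
  apply/bounded_funP; exists 1 => y; rewrite indicE ger0_norm ?ler0n//.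
  by rewrite lern1 leq_b1.
- by have := @lsc_prices_cst R d X SS 0 (lexx _) T.
Qed.

Lemma cost_indic_prices S (U : set (Y S)) : open U ->
  (cost P (indic_prices U))%:E = P S U.
Proof.
move=> oU; rewrite /cost (bigD1 S)//= big1 => [|T TS].
  rewrite addr0 /indic_prices dfwithin /Rintegral.
  have mU : measurable (U : set (borel (Y S))) by exact: measurable_open.
  under eq_integral do rewrite -/(\1_U _).
  by rewrite integral_indic// setIT fineK// fin_num_measure.
rewrite /indic_prices dfwithout 1?eq_sym// /Rintegral.
by rewrite integral0.
Qed.

Lemma total_indic_prices S (U : set (Y S)) x :
  total (indic_prices U) x = \1_U (restr_ S x).
Proof.
rewrite /total (bigD1 S)//= big1 => [|T TS].
  by rewrite addr0 /indic_prices dfwithin.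
by rewrite /indic_prices dfwithout// eq_sym.
Qed.

Hypothesis SS_neq0 : SS != finset.set0.

(** The additive functional given by Hahn-Banach is positive because the null
    prices dominate negative functions; the bound on a cylinder over an open
    set comes from the prices equal to its indicator at one member of [SS] and
    to zero at the others. *)
Lemma price_charge : exists m : charge R (full_space X),
  [/\ m setT = price P 1, m (~` @pinned d X SS) = 0 &
    forall S (U : set (Y S)), open U -> ((m (restr_ S @^-1` U))%:E <= P S U)%E].
Proof.
have [L [LD Lp L1]] := hahn_banach 1 (price_sublinear P SS_neq0).
have L0 : L 0 = 0 by have := LD 0 0; rewrite addr0; lra.
pose ind (A : set (full_space X)) : {fimfun full_space X >-> R} := \1_A.
have LN A : L (ind A) = - L (- ind A).
  by apply/eqP; rewrite -subr_eq0 opprK -LD subrr L0.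
have z0 : lsc_prices (fun (S : member SS) (_ : Y S) => 0 : R).
  exact: lsc_prices_cst.
have cost0 : cost P (fun (S : member SS) (_ : Y S) => 0) = 0.
  by rewrite /cost big1// => S _; rewrite /Rintegral integral0.
have total0 x : total (fun (S : member SS) (_ : Y S) => 0 : R) x = 0.
  by rewrite /total big1.
have L_ge0 A : 0 <= L (ind A).
  rewrite LN oppr_ge0 (le_trans (Lp _))// -cost0; apply: price_le => // x _.
  by rewrite total0 fimfunN /= oppr_le0 indicE ler0n.
have LU A B : A `&` B = set0 -> L (ind (A `|` B)) = L (ind A) + L (ind B).
  move=> AB; rewrite -LD; congr L; apply/fimfuneqP => x; rewrite fimfunD /=.
  rewrite !indicE in_setU; have [xA|xA] := boolP (x \in A); last first.
    by rewrite /= add0r.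
  rewrite (_ : x \in B = false) ?addr0//; apply/negP => xB.
  have : (A `&` B) x by rewrite inE in xA; rewrite inE in xB.
  by rewrite AB.
exists (Charge L_ge0 LU); split=> /=.
- rewrite -L1; congr L; apply/fimfuneqP => x.
  by rewrite fimfun1 /= indicT.
- apply/eqP; rewrite eq_le L_ge0 andbT (le_trans (Lp _))// -cost0.
  apply: price_le => // x px; rewrite total0 /= indicE memNset//; exact.
- move=> S U oU; rewrite -cost_indic_prices// lee_fin (le_trans (Lp _))//.
  apply: price_le; first exact: indic_prices_lsc.
  by move=> x _; rewrite total_indic_prices /= !indicE.
Qed.

End price_charge.

(** * The dominated charge extends to a Borel measure *)

Section primal.
Variables (R : realType) (d : nat) (X : 'I_d -> ptopologicalType).
Variable SS : {set {set 'I_d}}.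
Hypotheses (X_lc : forall j, locally_compact [set: X j])
  (X_T2 : forall j, hausdorff_space (X j))
  (X_sc : forall U : set (full_space X), open U -> sigma_compact U).
Variable P : distributions R X SS.

Notation Y S := (sub_space X (val S)).
Notation restr_ S := (@restr d X (val S)).
Notation pinned := (@pinned d X SS).
Implicit Types (S : member SS).

Lemma full_space_T2 : hausdorff_space (full_space X).
Proof. exact: (@hausdorff_product _ X). Qed.

Lemma sub_space_T2 (S : {set 'I_d}) : hausdorff_space (sub_space X S).
Proof.
by apply: (@hausdorff_product _ (fun j : {j : 'I_d | j \in S} => X (val j))).
Qed.

Lemma sub_space_lc (S : {set 'I_d}) : locally_compact [set: sub_space X S].
Proof. by apply: prod_locally_compact. Qed.

Lemma restr_open S (U : set (Y S)) : open U -> open (restr_ S @^-1` U).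
Proof. by move=> oU; apply: open_comp => // x _; exact: restr_continuous. Qed.

Lemma restr_closed S (F : set (Y S)) : closed F -> closed (restr_ S @^-1` F).
Proof.
by move=> cF; apply: preimage_closed => // x _; exact: restr_continuous.
Qed.

Lemma coord_open j (V : set (X j)) :
  open V -> open [set x : full_space X | V (x j)].
Proof.
move=> oV; apply: (@open_comp _ _ (fun x : full_space X => x j)) => // x _.
exact: (@proj_continuous _ X j x).
Qed.

Lemma coord_closed j (V : set (X j)) :
  closed V -> closed [set x : full_space X | V (x j)].
Proof.
move=> cV.
apply: (@preimage_closed _ _ (fun x : full_space X => x j)) => // x _.
exact: (@proj_continuous _ X j x).
Qed.

Lemma closed_pinned : closed pinned.
Proof.
rewrite (_ : pinned = \bigcap_(j in [set j | forall S, j \notin val S])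
  [set x : full_space X | [set point] (x j)]).
  apply: closed_bigI => j _; apply: coord_closed.
  by apply: accessible_closed_set1; apply: hausdorff_accessible.
by apply/seteqP; split=> [x px j /= /px|x px j jS]; [|exact: px].
Qed.

(** The set lies in a product of compact sets: at a coordinate of some [S], the
    projection of [K S]; at any other one, the base point. *)
Lemma compact_pinned (K : forall S, set (Y S)) : (forall S, compact (K S)) ->
  compact [set x | pinned x /\ forall S, K S (restr_ S x)].
Proof.
move=> cK.
have Cj j : exists C : set (X j), compact C /\
    forall x, pinned x -> (forall S, K S (restr_ S x)) -> C (x j).
  have [[S jS]|nS] := pselect (exists S : member SS, j \in val S).
    pose k : {j : 'I_d | j \in val S} := exist _ j jS.
    exists ((fun y : Y S => y k) @` K S); split.
      apply: continuous_compact (cK S); apply: continuous_subspaceT => y.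
      exact: (@proj_continuous _
        (fun k : {j : 'I_d | j \in val S} => X (val k)) k y).
    by move=> x _ Kx; exists (restr_ S x).
  exists [set point]; split; first exact: compact_set1.
  by move=> x px _; apply: px => S; apply/negP => jS; apply: nS; exists S.
pose C j := projT1 (cid (Cj j)).
have hC j : compact (C j) /\
    forall x, pinned x -> (forall S, K S (restr_ S x)) -> C j (x j) :=
  projT2 (cid (Cj j)).
have cC : compact (box C) by apply: tychonoff => j; case: (hC j).
apply: (subclosed_compact _ cC).
  rewrite (_ : mkset _ = pinned `&` \bigcap_S (restr_ S @^-1` K S)).
    apply: closedI; first exact: closed_pinned.
    apply: closed_bigI => S _; apply: restr_closed.
    by apply: compact_closed => //; exact: sub_space_T2.
  by apply/seteqP; split=> x [px Kx]; split=> // S; [move=> _|]; exact: Kx.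
by move=> x [px Kx] j; exact: (hC j).2.
Qed.

Variable m : charge R (full_space X).
Hypothesis m_pinned : m (~` pinned) = 0.
Hypothesis m_le : forall S (U : set (Y S)), open U ->
  ((m (restr_ S @^-1` U))%:E <= P S U)%E.

(** A pinned point that leaves the compact set has a restriction outside some
    [K S], and the charge of the cylinder over this open complement is at most
    its small mass under [P S]. *)
Lemma coupling_tight (e : R) : 0 < e ->
  exists K, [/\ compact K, closed K & m (~` K) <= e].
Proof.
(* The summand 1 keeps the denominator positive when [SS] is empty. *)
move=> e0; pose c := e / (#|{: member SS}|%:R + 1).
have c0 : 0 < c by rewrite divr_gt0// ltr_wpDl.
have KS S : exists K : set (Y S), compact K /\ (P S (~` K) <= c%:E)%E.
  have [V [K [oV cK VK PV]]] := borel_tight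
    (sub_space_sigma_compact X_sc) (P S) (@sub_space_lc _) c0.
  exists K; split=> //; apply: le_trans PV; apply: le_measure; rewrite ?inE.
  - apply: (@measurable_open (Y S) (~` K)); apply: closed_openC.
    exact: compact_closed (@sub_space_T2 _) cK.
  - exact: (@measurable_closed (Y S) (~` V) (open_closedC oV)).
  - exact: subsetC.
pose K S := projT1 (cid (KS S)).
have hK S : compact (K S) /\ (P S (~` (K S)) <= c%:E)%E := projT2 (cid (KS S)).
have cK : compact [set x | pinned x /\ forall S, K S (restr_ S x)].
  by apply: compact_pinned => S; case: (hK S).
exists [set x | pinned x /\ forall S, K S (restr_ S x)]; split=> //.
  by apply: compact_closed cK; exact: full_space_T2.
apply: (@le_trans _ _ (m (~` pinned) +
    \sum_(S : member SS) m (restr_ S @^-1` (~` K S)))).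
  apply: le_trans (lerD (lexx _) (charge_le_bigU _ _ _)).
  apply: le_trans (charge_le_U _ _ _); apply: le_charge => x /= nK.
  have [px|npx] := pselect (pinned x); [right|by left].
  apply: contrapT => nKS; apply: nK; split=> // S; apply: contrapT => nKx.
  by apply: nKS; rewrite (bigD1 S)//=; left.
rewrite m_pinned add0r.
apply: (@le_trans _ _ (\sum_(S : member SS) c)).
  apply: ler_sum => S _; rewrite -lee_fin; apply: le_trans (hK S).2.
  apply: (@m_le S (~` K S)); apply: closed_openC.
  exact: compact_closed (@sub_space_T2 _) (hK S).1.
rewrite sumr_const -mulr_natl /c mulrCA ger_pMr//.
by rewrite ler_pdivrMr ?mul1r ?lerDl// ltr_wpDl.
Qed.

Definition tight_coupling := TightCharge coupling_tight.

(** The gap between the outer and inner approximations is open, so the bound of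
    the charge by [P S] on open sets controls it. *)
Lemma regular_restr S (B : set (borel (Y S))) : measurable B ->
  charge_regular tight_coupling (restr_ S @^-1` B).
Proof.
move=> mB e e0; have e20 : 0 < e / 2 by rewrite divr_gt0.
have [F [U [cF oU FB BU PUF]]] := borel_regular (@sub_space_T2 _)
  (sub_space_sigma_compact X_sc) (P S) mB e20.
have [K [cK clK mK]] := charge_tight tight_coupling e20.
exists (restr_ S @^-1` F `&` K), (restr_ S @^-1` U); split.
- by rewrite setIC; apply: compact_closedI => //; exact: restr_closed.
- by apply: closedI => //; exact: restr_closed.
- exact: restr_open.
- by split=> [x [Fx _]|x]; [exact: FB|exact: BU].
- apply: (@le_trans _ _ (m (restr_ S @^-1` (U `\` F)) + m (~` K))).
    apply: le_trans (charge_le_U _ _ _); apply: le_charge => x [Ux nFK].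
    have [Kx|nKx] := pselect (K x); [left|by right].
    by split=> // Fx; apply: nFK.
  rewrite [e]splitr lerD// -lee_fin (le_trans _ PUF)//.
  apply: (@m_le S (U `\` F)); rewrite setDE.
  exact: openI oU (closed_openC cF).
Qed.

(** At a coordinate outside every member of [SS] the charge only sees the base
    point, so the set is either almost everything or negligible. *)
Lemma regular_coord j (V : set (X j)) : open V ->
  charge_regular tight_coupling [set x : full_space X | V (x j)].
Proof.
move=> oV; have [[S jS]|nS] := pselect (exists S : member SS, j \in val S).
  pose k : {j : 'I_d | j \in val S} := exist _ j jS.
  rewrite (_ : mkset _ = restr_ S @^-1` [set y : Y S | V (y k)]) //.
  apply: regular_restr; apply: (@measurable_open (Y S)).
  apply: (@open_comp (Y S) (X j) (fun y : Y S => y k)) => // y _.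
  exact: (@proj_continuous _
    (fun k : {j : 'I_d | j \in val S} => X (val k)) k y).
have pj x : pinned x -> x j = point.
  by move=> /(_ j); apply=> S; apply/negP => jS; apply: nS; exists S.
have oA := coord_open oV; have [Vp|nVp] := pselect (V point); move=> e e0.
  have [K [cK clK mK]] := charge_tight tight_coupling e0.
  exists (K `&` pinned), [set x : full_space X | V (x j)]; split=> //.
  - by apply: compact_closedI => //; exact: closed_pinned.
  - by apply: closedI => //; exact: closed_pinned.
  - by split=> // x [_ /pj] /= ->.
  - apply: (@le_trans _ _ (m (~` K) + m (~` pinned))); last first.
      by rewrite m_pinned addr0.
    apply: le_trans (charge_le_U _ _ _); apply: le_charge => x [_ nKp].
    have [Kx|nKx] := pselect (K x); [right|by left].
    by move=> px; apply: nKp.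
exists set0, [set x : full_space X | V (x j)]; split=> //.
- exact: compact0.
- exact: closed0.
- by split.
- rewrite setD0 (le_trans _ (ltW e0))// -m_pinned; apply: le_charge => x /= Vx.
  by move=> /pj xp; apply: nVp; rewrite -xp.
Qed.

Theorem coupling_extension :
  exists nu : {measure set (borel (full_space X)) -> \bar R},
    nu setT = (m setT)%:E /\
    forall S (B : set (borel (Y S))), measurable B ->
      (nu (restr_ S @^-1` B) <= P S B)%E.
Proof.
have [//|U x oU Ux|nu hnu] := @charge_extension R (full_space X) tight_coupling.
  have [V hV VU] := nbhs_box (open_nbhs_nbhs (conj oU Ux)).
  exists (box V); split=> //.
  - by apply: box_open => j; case: (hV j).
  - by move=> j; case: (hV j).
  - rewrite (_ : box V = \big[setI/setT]_j [set x : full_space X | V j (x j)]).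
      elim/big_ind: _ => [||j _].
      + exact: charge_regularT.
      + exact: charge_regularI.
      + by apply: regular_coord; case: (hV j).
    apply/seteqP; split=> y.
      by move=> Vy; elim/big_ind: _ => // j _; exact: Vy.
    by move=> By j; move: By; rewrite (bigD1 j)//= => -[].
exists nu; split; first by apply: hnu; exact: charge_regularT.
move=> S B mB; rewrite hnu; last exact: regular_restr.
apply/lee_addgt0Pr => e e0.
have [F [U [cF oU FB BU PUF]]] := borel_regular (@sub_space_T2 _)
  (sub_space_sigma_compact X_sc) (P S) mB e0.
have mU : measurable (U : set (borel (Y S))) := @measurable_open (Y S) U oU.
have mF : measurable (F : set (borel (Y S))) := @measurable_closed (Y S) F cF.
apply: (@le_trans _ _ (P S U)).
  apply: le_trans (m_le oU); rewrite lee_fin.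
  by apply: le_charge => x; exact: BU.
apply: (@le_trans _ _ (P S (B `|` (U `\` F)))).
  apply: le_measure; rewrite ?inE//.
    by apply: measurableU => //; exact: measurableD.
  move=> y Uy; have [Fy|nFy] := pselect (F y); [left; exact: FB|by right].
apply: (le_trans (measureU2 _ _ _)) => //; first exact: measurableD.
exact: leeD.
Qed.

End primal.

(** * From lower to upper semicontinuous prices *)

(** Local compactness and the Hausdorff property give regularity, which turns
    the open neighborhood from semicontinuity into a closed one. *)
Lemma lsc_closed_nbhs (R : realType) (Y : ptopologicalType) (f : Y -> R) y
    (e : R) : locally_compact [set: Y] -> hausdorff_space Y -> lsc f -> 0 < e ->
  exists C : set Y, [/\ closed C, nbhs y C & forall z, C z -> f y - e < f z].
Proof.
move=> lY hY lf e0; have [V + [cV _]] := lY y Logic.I; rewrite withinET => Vy.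
have fe : f y - e < f y by rewrite ltrBlDr ltrDl.
have [B By BU] := compact_regular hY cV Vy (lf y _ fe).
exists (closure B); split; first exact: closed_closure.
  by apply: filterS By; exact: subset_closure.
by move=> z /BU.
Qed.

Lemma usc_bigmax (R : realType) (Y : ptopologicalType) (I : Type) (s : seq I)
    (f : I -> Y -> R) : (forall i, upper_semicontinuous (f i)) ->
  upper_semicontinuous (fun y => \big[Num.max/0]_(i <- s) f i y).
Proof.
move=> uf; elim: s => [|i s IHs].
  under eq_fun do rewrite big_nil; exact: usc_cst.
under eq_fun do rewrite big_cons; exact: usc_max.
Qed.

Section dual.
Variables (R : realType) (d : nat) (X : 'I_d -> ptopologicalType).
Variable SS : {set {set 'I_d}}.
Hypotheses (X_lc : forall j, locally_compact [set: X j])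
  (X_T2 : forall j, hausdorff_space (X j)).

Notation Y S := (sub_space X (val S)).
Notation restr_ S := (@restr d X (val S)).
Notation pinned := (@pinned d X SS).
Notation prices := (forall S : member SS, Y S -> R).
Notation n := (#|{: member SS}|%:R).
Implicit Types (S : member SS) (g h : prices).

(** Near each point [x] of [K] the value of [g S] stays above
    [g S (x_S) - e] on a closed neighborhood.  The minorant is the maximum, over
    a finite subcover of [K], of the positive parts of these constants times
    the indicators of the closed neighborhoods. *)
Lemma usc_minorant g (K : set (full_space X)) (c e : R) :
  lsc_prices g -> compact K -> (forall x, K x -> c <= total g x) -> 0 < e ->
  exists h, (forall S, upper_semicontinuous (h S) /\
                       forall y, 0 <= h S y <= g S y) /\
            forall x, K x -> c - n * e <= total h x.
Proof.
move=> pg cK gK e0.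
have exC (x : full_space X) S : exists C : set (Y S),
    [/\ closed C, nbhs (restr_ S x) C &
      forall z, C z -> g S (restr_ S x) - e < g S z].
  have [_ lg _] := pg S.
  apply: lsc_closed_nbhs => //; [exact: sub_space_lc|exact: sub_space_T2].
pose C x S := projT1 (cid (exC x S)).
have hC x S : [/\ closed (C x S), nbhs (restr_ S x) (C x S) &
    forall z, C x S z -> g S (restr_ S x) - e < g S z] :=
  projT2 (cid (exC x S)).
pose N x := [set z : full_space X | forall S, (C x S)° (restr_ S z)].
have oN x : open (N x).
  rewrite (_ : N x =
    \big[setI/setT]_(S : member SS) (restr_ S @^-1` (C x S)°)).
    elim/big_ind: _ => [|A B|S _]; [exact: openT|exact: openI|].
    by apply: restr_open; exact: open_interior.
  apply/seteqP; split=> z.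
    by move=> Nz; elim/big_ind: _ => // S _; exact: Nz.
  by move=> Bz S; move: Bz; rewrite (bigD1 S)//= => -[].
(* The centers are taken in [K], where the bound by [c] is available. *)
have [D DK KD] : finite_subset_cover K N K.
  move: cK; rewrite {1}compact_cover; apply=> [x _|x Kx]; first exact: oN.
  by exists x => // S; case: (hC x S).
pose w x S (y : Y S) := Num.max 0 (g S (restr_ S x) - e) * \1_(C x S) y : R.
have w_le x S y : w x S y <= g S y.
  rewrite /w indicE; have [xy|_] := boolP (y \in C x S); last first.
    by rewrite mulr0; case: (pg S).
  rewrite mulr1 ge_max; case: (pg S) => _ _ ->/=; apply: ltW.
  by case: (hC x S) => _ _; apply; rewrite inE in xy.
exists (fun S y => \big[Num.max/0]_(x <- D) w x S y); split=> [S|z Kz].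
  split=> [|y].
    apply: usc_bigmax => x; apply: uscZ; first by rewrite le_max lexx.
    by apply: usc_indic; case: (hC x S).
  apply/andP; split; first exact: bigmax_ge_id.
  by apply: bigmax_le => // ; case: (pg S).
have [x /= xD Nz] := KD z Kz.
have Kx : K x by have := DK _ xD; rewrite inE.
rewrite lerBlDr (le_trans (gK x Kx))// /total.
rewrite (_ : n * e = \sum_(S : member SS) e); last first.
  by rewrite sumr_const mulr_natl.
rewrite -big_split /=; apply: ler_sum => S _.
rewrite -lerBlDr; apply: (@le_trans _ _ (w x S (restr_ S z))).
  rewrite /w indicE mem_set ?mulr1 ?le_max ?lexx ?orbT//.
  exact: interior_subset (Nz S).
exact: (le_bigmax_seq 0 x xpredT).
Qed.


Definition pin (x : full_space X) : full_space X :=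
  fun j => if pselect (exists S : member SS, j \in val S) then x j else point.

Lemma pin_pinned x : pinned (pin x).
Proof.
move=> j nS; rewrite /pin; case: pselect => // -[S jS].
by have := nS S; rewrite jS.
Qed.

Lemma restr_pin S x : restr_ S (pin x) = restr_ S x.
Proof.
apply: functional_extensionality_dep => -[j jS]; rewrite /restr /pin /=.
by case: pselect => // nS; exfalso; apply: nS; exists S.
Qed.

Hypothesis X_sc : forall U : set (full_space X), open U -> sigma_compact U.
Variable P : distributions R X SS.

Definition usc_prices g := forall S,
  [/\ bounded_fun (g S), upper_semicontinuous (g S) & forall y, 0 <= g S y].

Lemma usc_prices_integrable g S : usc_prices g ->
  (P S).-integrable [set: borel (Y S)] (EFin \o g S).
Proof.
move=> /(_ S)[bg ug _]; apply: bounded_measurable_integrable => //.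
exact: usc_measurable.
Qed.

(** Half of [e] pays for the loss of the minorants on the compact set, as a
    constant added to each price; the other half bounds the integral of the
    indicator of the complement of [V S], which alone reaches 1 at the points
    that leave the compact set. *)
Lemma usc_prices_approx g (e : R) : lsc_prices g ->
  (forall x, pinned x -> 1 <= total g x) -> 0 < e ->
  exists h, [/\ usc_prices h, forall x, 1 <= total h x &
    cost P h <= cost P g + n * e].
Proof.
move=> pg g1 e0; have e20 : 0 < e / 2 by rewrite divr_gt0.
have exV S : exists VK : set (Y S) * set (Y S),
    [/\ open VK.1, compact VK.2, VK.1 `<=` VK.2 &
      (P S (~` VK.1) <= (e / 2)%:E)%E].
  have [V [K ?]] := borel_tight (sub_space_sigma_compact X_sc)
    (P S) (sub_space_lc X_lc X_T2 (S := val S)) e20.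
  by exists (V, K).
pose V S := (projT1 (cid (exV S))).1; pose K S := (projT1 (cid (exV S))).2.
have hVK S : [/\ open (V S), compact (K S), V S `<=` K S &
  (P S (~` V S) <= (e / 2)%:E)%E] := projT2 (cid (exV S)).
have cK : compact [set x | pinned x /\ forall S, K S (restr_ S x)].
  by apply: compact_pinned => // S; case: (hVK S).
have [x [px _]|h [hg hK]] := @usc_minorant g _ 1 _ pg cK _ e20.
  exact: g1.
have clV S : closed (~` V S) by apply: open_closedC; case: (hVK S).
have pc : usc_prices (fun S (y : Y S) => e / 2 + \1_(~` V S) y : R).
  move=> S; split.
  - apply/bounded_funP; exists (e / 2 + 1) => y; rewrite ger0_norm.
      by rewrite lerD2l indicE lern1 leq_b1.
    by rewrite addr_ge0 ?indicE ?ler0n// ltW.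
  - by apply: uscD; [exact: usc_cst|exact: usc_indic].
  - by move=> y; rewrite addr_ge0 ?indicE ?ler0n// ltW.
have ph : usc_prices h.
  move=> S; have [uh h0] := hg S; have [/bounded_funP[M gM] _ _] := pg S.
  split=> // [|y]; last by have /andP[] := h0 y.
  apply/bounded_funP; exists M => y; have /andP[hy hgy] := h0 y.
  by rewrite ger0_norm// (le_trans hgy)// (le_trans _ (gM y))// ler_norm.
exists (fun S (y : Y S) => h S y + (e / 2 + \1_(~` V S) y)); split.
- move=> S; have [bh uh h0] := ph S; have [bc uc c0] := pc S; split.
  + have /bounded_funP[M hM] := bh; have /bounded_funP[N cN] := bc.
    apply/bounded_funP; exists (M + N) => y.
    by rewrite (le_trans (ler_normD _ _))// lerD.
  + exact: uscD.
  + by move=> y; rewrite addr_ge0.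
- move=> x; rewrite /total.
  have [Vx|/existsNP[S nVx]] := pselect (forall S, V S (restr_ S x)).
    (* Pinning keeps the restrictions and leads into the compact set. *)
    have := hK (pin x); rewrite /total; under eq_bigr do rewrite restr_pin.
    move=> h1; rewrite big_split /= -lerBlDr; apply: le_trans (h1 _).
      rewrite lerD2l lerN2 mulr_natl -sumr_const; apply: ler_sum => S _.
      by rewrite lerDl indicE ler0n.
    split=> [|S]; first exact: pin_pinned.
    by rewrite restr_pin; case: (hVK S) => _ _ + _; exact.
  rewrite (bigD1 S)//= ler_wpDr ?sumr_ge0// => [T _|].
    by have [_ _ h0] := ph T; have [_ _ c0] := pc T; rewrite addr_ge0.
  rewrite indicE mem_set// -[leLHS]add0r lerD//; first by case: (ph S).
  by rewrite lerDr ltW.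
- rewrite mulr_natl -sumr_const /cost -big_split; apply: ler_sum => S _ /=.
  have mV : measurable (~` V S : set (borel (Y S))) :=
    measurable_closed (clV S).
  have ih := usc_prices_integrable S ph; have ic := usc_prices_integrable S pc.
  rewrite RintegralD//; apply: lerD.
    apply: le_Rintegral => //; first exact: lsc_prices_integrable.
    by move=> y _; have [_ /(_ y)/andP[]] := hg S.
  rewrite RintegralD//; last 2 first.
  + apply: bounded_measurable_integrable => //.
    by apply/bounded_funP; exists `|e / 2|.
  + apply: bounded_measurable_integrable; last first.
      exact: usc_measurable (usc_indic (clV S)).
    apply/bounded_funP; exists 1 => y; rewrite indicE ger0_norm ?ler0n//.
    by rewrite lern1 leq_b1.
  rewrite [leRHS]splitr; apply: lerD.
    rewrite Rintegral_cst// -[leRHS]mulr1 ler_wpM2l// ?(ltW e20)//.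
    rewrite (_ : fine _ = fine (1%E : \bar R))//; congr fine.
    exact: probability_setT.
  rewrite /Rintegral integral_indic// setIT -lee_fin fineK ?fin_num_measure//.
  by case: (hVK S).
Qed.

End dual.

(** * Mixtures and subcouplings *)

(** The difference is set to zero on non-measurable sets, where it could fail to
    be defined or nonnegative. *)
Lemma measure_difference (dd : measure_display) (T : measurableType dd)
    (R : realType) (m1 m2 : {measure set T -> \bar R}) :
  (m2 setT < +oo)%E -> (forall A, measurable A -> (m1 A <= m2 A)%E) ->
  exists m : {measure set T -> \bar R},
    forall A, measurable A -> m2 A = (m1 A + m A)%E.
Proof.
move=> m2oo m12.
have fin2 A : measurable A -> m2 A \is a fin_num.
  move=> mA; rewrite ge0_fin_numE// (le_lt_trans _ m2oo)//.
  by apply: le_measure; rewrite ?inE.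
have fin1 A : measurable A -> m1 A \is a fin_num.
  move=> mA; rewrite ge0_fin_numE// (le_lt_trans (m12 _ mA))//.
  by rewrite -ge0_fin_numE// fin2.
pose m A : \bar R := if pselect (measurable A) then (m2 A - m1 A)%E else 0%E.
have mE A : measurable A -> m A = (m2 A - m1 A)%E.
  by move=> mA; rewrite /m; case: pselect.
have m0 : m set0 = 0%E by rewrite mE// !measure0 subee.
have m_ge0 A : (0 <= m A)%E.
  by rewrite /m; case: pselect => //= mA; rewrite sube_ge0 ?m12// fin1.
have m_sigma : semi_sigma_additive m.
  move=> F mF tF mUF; rewrite mE//.
  rewrite (_ : (fun n => _) = (fun n => \sum_(0 <= i < n) m2 (F i) -
                                        \sum_(0 <= i < n) m1 (F i))%E).
    apply: cvgeB; first by rewrite fin_num_adde_defr// fin2.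
      exact: measure_semi_sigma_additive.
    exact: measure_semi_sigma_additive.
  apply/funext => n; elim: n => [|n IHn]; first by rewrite !big_geq// subee.
  rewrite !big_nat_recr//= IHn mE// fin_num_oppeD ?fin1//.
  by rewrite addeACA.
pose mm := isMeasure.Build _ _ _ m m0 m_ge0 m_sigma.
pose m' : {measure set T -> \bar R} := HB.pack m mm.
exists m' => A mA; rewrite /= mE// addeC subeK// fin1//.
Qed.

(** At [c = 0] the normalization is the arbitrary [Q], but both sides vanish. *)
Lemma mnormalizeE (dd : measure_display) (T : measurableType dd)
    (R : realType) (m : {measure set T -> \bar R}) (Q : probability T R)
    (c : R) (A : set T) :
  measurable A -> m setT = c%:E -> m A = (c%:E * mnormalize m Q A)%E.
Proof.
move=> mA mT; rewrite /mnormalize mT /= orbF eqe.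
have [c0|c0] := eqVneq c 0.
  have m0 : m setT = 0%E by rewrite mT c0.
  rewrite c0 mul0e; apply/eqP; rewrite eq_le measure_ge0 andbT.
  by rewrite -m0; apply: le_measure; rewrite ?inE.
by rewrite muleCA -EFinM divff// mule1.
Qed.

Section subcouplings.
Variables (R : realType) (d : nat) (X : 'I_d -> ptopologicalType).
Variable SS : {set {set 'I_d}}.

Notation Y S := (sub_space X (val S)).
Notation restr_ S := (@restr d X (val S)).
Notation borel_restr S :=
  (@restr d X (val S) : borel (full_space X) -> borel (Y S)).
Implicit Types (P : distributions R X SS) (S : member SS).

Lemma restr_measurable S : measurable_fun setT (borel_restr S).
Proof.
apply: (@measurability _ _ (borel (full_space X)) (borel (Y S)) setT _
  (@open (Y S))) => //.
move=> _ [U oU <-]; rewrite setTI; apply: (@measurable_open (full_space X)).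
exact: restr_open.
Qed.

HB.instance Definition _ S :=
  isMeasurableFun.Build _ _ _ _ (borel_restr S) (@restr_measurable S).

Definition subcoupling P
    (nu : {measure set (borel (full_space X)) -> \bar R}) :=
  forall S (B : set (borel (Y S))), measurable B ->
    (nu (restr_ S @^-1` B) <= P S B)%E.

Lemma mixture_subcoupling P e : 0 <= e <= 1 ->
  mixture (1 - e) (@compatible R d X SS) e setT P ->
  exists2 nu, subcoupling P nu & nu setT = (1 - e)%:E.
Proof.
move=> /andP[e0 e1] [Q [mu muQ] [T _ PQT]].
have e1' : 0 <= 1 - e by rewrite subr_ge0.
exists (mscale (NngNum e1') mu).
  move=> S B mB; rewrite PQT// muQ// /mscale /= leeDl//.
  by rewrite mule_ge0// lee_fin.
by rewrite /mscale /= -[RHS]mule1; congr (_ * _)%E; exact: probability_setT.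
Qed.

(** The subcoupling and the remainders all have total mass independent of the
    index, namely [1 - e] and [e], so that normalizing them gives the two
    components of the mixture. *)
Lemma subcoupling_mixture P e nu : 0 <= e <= 1 ->
  subcoupling P nu -> nu setT = (1 - e)%:E ->
  mixture (1 - e) (@compatible R d X SS) e setT P.
Proof.
move=> /andP[e0 e1] nuP nuT.
(* The Dirac measure is the normalization of a null [nu]. *)
pose mu := mnormalize nu (dirac (point : borel (full_space X))).
pose Q : distributions R X SS := fun S => distribution mu (borel_restr S).
have rest S : exists T : {measure set (borel (Y S)) -> \bar R},
    forall B, measurable B ->
      P S B = (nu (restr_ S @^-1` B) + T B)%E.
  have [nuS nuSE] := image_measure nu (@restr_measurable S).
  have [|B mB|T hT] := @measure_difference _ _ _ nuS (P S).
  - by rewrite -ge0_fin_numE// fin_num_measure.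
  - by rewrite nuSE; exact: nuP.
  - by exists T => B /hT ->; rewrite nuSE.
pose D S := projT1 (cid (rest S)).
have hD S B : measurable B ->
    P S B = (nu (restr_ S @^-1` B) + D S B)%E := projT2 (cid (rest S)) B.
have DT S : D S setT = e%:E.
  have PT : P S setT = 1%E := probability_setT (P S).
  have := hD S setT measurableT; rewrite PT preimage_setT nuT.
  case: (D S setT) => [r|//|//] [H]; congr EFin.
  by rewrite -(addKr (1 - e) r) -H opprB subrK.
exists Q.
  by exists mu => S B mB.
exists (fun S => mnormalize (D S) (P S)) => // S B mB.
rewrite hD//; congr (_ + _)%E; last exact: mnormalizeE.
apply: mnormalizeE nuT; rewrite -[X in measurable X]setTI.
exact: restr_measurable.
Qed.

(** Integration of [1 + f S], which is nonnegative, against the marginals of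
    [nu] and against the larger [P S]; the sum over [S] is at least [#|SS|]
    everywhere. *)
Lemma weak_duality P nu (f : forall S, Y S -> R) :
  SS != finset.set0 -> subcoupling P nu -> usc_family f ->
  (nu setT <= (1 - incompat_at P f)%:E)%E.
Proof.
move=> SS0 nuP [uf f_inf].
pose n : R := #|SS|%:R.
have n0 : 0 < n by rewrite ltr0n lt0n cards_eq0.
have nE : n = \sum_(S : member SS) 1 by rewrite sumr_const card_sig.
have f_sum x : 0 <= \sum_S f S (restr_ S x).
  apply: le_trans f_inf _; apply: ge_inf; last by exists x.
  exists (\sum_(S : member SS) -1) => _ [z _ <-]; apply: ler_sum => S _.
  by case: (uf S) => _ _; exact.
have f1 S y : (0 <= (1 + f S y)%:E)%E.
  by rewrite lee_fin -lerBlDl sub0r; case: (uf S).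
have mf S : measurable_fun [set: borel (Y S)] (f S).
  by case: (uf S) => _ ufS _; exact: usc_measurable.
have m1f S : measurable_fun [set: borel (Y S)] 
      (fun y : borel (Y S) => (1 + f S y)%:E : \bar R).
  by apply/measurable_EFinP; exact: measurable_funD.
have le_S S : (\int[nu]_x (1 + f S (restr_ S x))%:E <=
               (1 + \int[P S]_y f S y)%:E)%E.
  have iF : (P S).-integrable [set: borel (Y S)] (EFin \o f S).
    by apply: bounded_measurable_integrable => //; case: (uf S).
  have i1 : (P S).-integrable [set: borel (Y S)] (EFin \o cst 1).
    apply: bounded_measurable_integrable => //.
    by apply/bounded_funP; exists `|1|.
  have -> : (1 + \int[P S]_y f S y)%:E = (\int[P S]_y (1 + f S y)%:E)%E.
    rewrite [RHS](_ : _ = \int[P S]_y ((cst 1 y)%:E + (f S y)%:E)%E)%E//.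
    rewrite integralD_EFin// EFinD; congr (_ + _)%E.
      rewrite -(probability_setT (P S)) -[LHS]mul1e -integral_cst//.
    by rewrite /Rintegral fineK//; exact: integrable_fin_num.
  rewrite -(@ge0_integral_pushforward _ _ _ _ _ _ (@restr_measurable S) nu setT
    (fun y : borel (Y S) => (1 + f S y)%:E : \bar R))//.
  by apply: ge0_le_measure_integral => // B mB; exact: nuP.
have := lee_sum (index_enum (member SS)) (fun S (_ : true) => le_S S).
rewrite -ge0_integral_sum//; last first.
  by move=> S; exact: (measurableT_comp (m1f S) (@restr_measurable S)).
rewrite sumEFin big_split /= -nE => le_int.
rewrite -(@lee_pmul2l _ n%:E)//.
apply: (@le_trans _ _ (\int[nu]_x (cst n%:E) x)%E).
  by rewrite integral_cst.
apply: le_trans (le_trans le_int _).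
  apply: ge0_le_integral => //.
  - by move=> x _; rewrite lee_fin ltW.
  - apply: emeasurable_sum => S _.
    exact: (measurableT_comp (m1f S) (@restr_measurable S)).
  - move=> x _; rewrite sumEFin lee_fin big_split /= -nE lerDl; exact: f_sum.
rewrite lee_fin /incompat_at opprK mulrDr mulr1 -/n mulrA divff ?mul1r//.
by rewrite gt_eqF.
Qed.

End subcouplings.

(** * Equality of the two optimal values *)

Section strong_duality.
Variables (R : realType) (d : nat) (X : 'I_d -> ptopologicalType).
Variable SS : {set {set 'I_d}}.
Hypothesis SS_neq0 : SS != finset.set0.
Hypotheses (X_lc : forall j, locally_compact [set: X j])
  (X_T2 : forall j, hausdorff_space (X j))
  (X_sc : forall U : set (full_space X), open U -> sigma_compact U).
Variable P : distributions R X SS.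

Notation Y S := (sub_space X (val S)).
Notation restr_ S := (@restr d X (val S)).
Implicit Types (S : member SS).

(** The optimum of the primal problem is attained, with the dual value as
    total mass. *)
Lemma exists_subcoupling : exists2 nu, subcoupling P nu &
  nu setT = (price P 1)%:E.
Proof.
have [m [mT m_pinned m_le]] := price_charge P SS_neq0.
have [nu [nuT nuP]] := coupling_extension X_lc X_T2 X_sc m_pinned m_le.
by exists nu; rewrite // nuT mT.
Qed.

Lemma price1_bounds : 0 <= price P 1 <= 1.
Proof.
have [nu nuP nuT] := exists_subcoupling.
rewrite -!lee_fin -nuT measure_ge0 /=.
have [T TSS] : exists T : {set 'I_d}, T \in SS by apply/finset.set0Pn.
pose S : member SS := exist _ T TSS.
have := nuP S setT measurableT; rewrite preimage_setT => /le_trans; apply.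
by rewrite le_eqVlt; apply/orP; left; apply/eqP; exact: probability_setT.
Qed.

(** Prices [h] give the test functions [n * h S - 1], with [n] the number of
    members of [SS]; the index at these functions is one minus the cost. *)
Lemma incompat_at_approx (e : R) : 0 < e ->
  exists2 f : forall S, Y S -> R, usc_family f &
    1 - price P 1 - e <= incompat_at P f.
Proof.
move=> e0; have e20 : 0 < e / 2 by rewrite divr_gt0.
pose n : R := #|SS|%:R.
have n0 : 0 < n by rewrite ltr0n lt0n cards_eq0.
have nE : n = #|{: member SS}|%:R by rewrite card_sig.
have bnd1 : bounded_fun (1 : {fimfun full_space X >-> R}).
  exact: fimfun_bounded.
have [g0 pg0 g0_1] := dominates_ex SS_neq0 bnd1.
have [_ [g [pg g1] <-] gm] : exists2 c,
    [set cost P g | g in [set g | lsc_prices g /\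
      dominates g (1 : {fimfun full_space X >-> R})]] c & c < price P 1 + e / 2.
  apply: inf_adherent => //; split; first by exists (cost P g0); exists g0.
  by exists 0 => _ [h [ph _] <-]; exact: cost_ge0.
have e2n0 : 0 < e / 2 / n by rewrite divr_gt0.
have g1' x : @pinned d X SS x -> 1 <= total g x by move=> /g1; rewrite fimfun1.
have [h [ph h1 hg]] := usc_prices_approx X_lc X_T2 X_sc P pg g1' e2n0.
have {}hg : cost P h <= price P 1 + e.
  rewrite (le_trans hg)// -nE mulrC divfK ?gt_eqF// [in leRHS](splitr e) addrA.
  by rewrite lerD2r ltW.
have pnh : usc_prices (fun S (y : Y S) => n * h S y).
  move=> S; have [/bounded_funP[M hM] uh h0] := ph S; split.
  - apply/bounded_funP; exists (n * M) => y.
    by rewrite normrM gtr0_norm// ler_pM2l.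
  - exact: (uscZ (ltW n0) uh).
  - by move=> y; rewrite mulr_ge0// ltW.
exists (fun S y => n * h S y - 1); first split.
- move=> S; have [/bounded_funP[M hM] uh h0] := pnh S; split.
  + apply/bounded_funP; exists (M + 1) => y.
    by rewrite (le_trans (ler_normB _ _))// normr1 lerD2r.
  + exact: (uscD uh (@usc_cst R (Y S) (-1))).
  + by move=> y; rewrite -[leLHS]add0r lerD2r.
- apply: lb_le_inf.
    exists (\sum_(S : member SS) (n * h S (restr_ S point) - 1)).
    by exists point.
  move=> _ [x _ <-]; rewrite big_split /= -mulr_sumr sumrN sumr_const -nE.
  by rewrite subr_ge0 ler_peMr ?(ltW n0)//; exact: h1.
- rewrite /incompat_at -/n.
  have -> : \sum_(S : member SS) \int[P S]_x (n * h S x - 1) = n * cost P h - n.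
    rewrite (_ : n * cost P h - n =
        \sum_(S : member SS) (n * \int[P S]_x h S x - 1)); last first.
      by rewrite sumrB -mulr_sumr sumr_const nE.
    apply: eq_bigr => S _.
    have ih := usc_prices_integrable P S ph.
    rewrite RintegralB//.
    + rewrite RintegralZl//; congr (_ - _).
      rewrite Rintegral_cst// mul1r.
      rewrite (_ : 1 = fine (1%E : \bar R))//; congr fine.
      exact: probability_setT.
    + exact: (usc_prices_integrable P S pnh).
    + apply: bounded_measurable_integrable => //.
      by apply/bounded_funP; exists `|1|.
  rewrite mulrBr mulVf ?gt_eqF// mulKf ?gt_eqF//; lra.
Qed.

End strong_duality.

Theorem theorem2 (R : realType) (d : nat) (X : 'I_d -> ptopologicalType)
    (SS : {set {set 'I_d}}) (SS_neq0 : SS != finset.set0)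
    (X_lc : forall j, locally_compact [set: X j])
    (X_T2 : forall j, hausdorff_space (X j))
    (X_sc : forall U : set (full_space X), open U -> sigma_compact U)
    (P : distributions R X SS) :
  incompat_index P =
    inf [set e : R | 0 <= e <= 1 /\
           mixture (1 - e) (@compatible R d X SS) e setT P] /\
  inf [set e : R | 0 <= e <= 1 /\
         mixture (1 - e) (@compatible R d X SS) e setT P] =
    1 - sup [set e : R | 0 <= e <= 1 /\
               mixture e (@compatible R d X SS) (1 - e) setT P].
Proof.
set E0 := [set e : R | _ /\ mixture (1 - e) _ e _ _].
set E1 := [set e : R | _ /\ mixture e _ (1 - e) _ _].
have E01 e : E1 (1 - e) <-> E0 e.
  rewrite /E0 /E1 /= subKr subr_ge0 gerBl.
  by split=> -[/andP[? ?] ?]; split=> //; apply/andP.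
have E0_lb : has_lbound E0 by exists 0 => e [/andP[]].
have E1_ub : has_ubound E1 by exists 1 => e [/andP[]].
have [nu nuP nuT] := exists_subcoupling SS_neq0 X_lc X_T2 X_sc P.
have E0m : E0 (1 - price P 1).
  have /andP[m0 m1] := price1_bounds SS_neq0 X_lc X_T2 X_sc P.
  have b : 0 <= 1 - price P 1 <= 1 by rewrite subr_ge0 m1 gerBl.
  by split=> //; apply: (subcoupling_mixture b nuP); rewrite subKr.
have weak e f : E0 e -> usc_family f -> incompat_at P f <= e.
  move=> [b mixP] uf; have [mu muP muT] := mixture_subcoupling b mixP.
  have := weak_duality SS_neq0 muP uf; rewrite muT lee_fin; lra.
split.
- apply/eqP; rewrite eq_le; apply/andP; split.
    apply: lb_le_inf; first by exists (1 - price P 1).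
    move=> e E0e; apply: ge_sup => [|_ [f uf <-]]; last exact: weak.
    have [f uf _] := incompat_at_approx SS_neq0 X_lc X_T2 X_sc P ltr01.
    by exists (incompat_at P f); exists f.
  apply: (le_trans (ge_inf E0_lb E0m)); apply/ler_addgt0Pr => e e0.
  have [f uf fe] := incompat_at_approx SS_neq0 X_lc X_T2 X_sc P e0.
  rewrite -lerBlDr (le_trans fe)//; apply: ub_le_sup; last by exists f.
  by exists (1 - price P 1) => _ [h uh <-]; exact: weak.
- apply/eqP; rewrite eq_le; apply/andP; split.
    rewrite lerBrDr -lerBrDl; apply: ge_sup.
      by exists (price P 1); rewrite -(subKr 1 (price P 1)); apply/E01.
    move=> e E1e; rewrite lerBrDl -lerBrDr; apply: ge_inf => //.
    by apply/E01; rewrite subKr.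
  apply: lb_le_inf; first by exists (1 - price P 1).
  move=> e /E01 E1e; rewrite lerBlDr -lerBlDl; exact: ub_le_sup.
Qed.
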